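(* Let $D$ be a trigonometric $\Lambda^+$-valued divisor satisfying the integrality assumption, and $T_D(z)$ its trigonometric Lax matrix. Then $\mathsf T_D(z):=z^{\epsilon^\vee_1(\lambda+\mu^-)}\mathsf Z_0(z)^{-1}T_D(z)$ has all entries in $\widetilde{\mathcal A}^v[z]$, i.e. $\mathsf T_D(z)\in\widetilde{\mathcal A}^v[z]\otimes_{\mathbb{C}}\mathrm{End}\,\mathbb{C}^n$.
   Context: Let $n\ge2$, $\Lambda=\bigoplus_{j=1}^n\mathbb{Z}\epsilon_j$, $\epsilon^\vee_j$ dual basis, $\alpha^\vee_i=\epsilon^\vee_i-\epsilon^\vee_{i+1}$, $\alpha_i=\epsilon_i-\epsilon_{i+1}$, $\varpi_i=-\sum_{j>i}\epsilon_j$ ($0\le i\le n-1$), $\Lambda^+=\{\nu:\alpha^\vee_i(\nu)\ge0\ \forall i\}$. A trigonometric $\Lambda^+$-valued divisor: $D=\sum_{s=1}^N\gamma_s\varpi_{i_s}[\mathsf x_s]+\mu^+[\infty]+\mu^-[0]$, $0\le i_s\le n-1$, $\mathsf x_s\in\mathbb{C}^\times$, $\gamma_s=1$ if $i_s\ne0$, $\gamma_s\in\{\pm1\}$ if $i_s=0$, $\mu^\pm\in\Lambda^+$; $\lambda=\sum_s\gamma_s\varpi_{i_s}$, $\lambda_{\mathsf x}=\sum_{s:\mathsf x_s=\mathsf x}\gamma_s\varpi_{i_s}$. Integrality assumption: $\lambda+\mu^++\mu^-=\sum_{i=1}^{n-1}a_i\alpha_i$, $a_i\in\mathbb{Z}_{\ge0}$;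 $a_0=a_n=0$. $\widetilde{\mathcal A}^v$: the $\mathbb{C}[v,v^{-1}]$-algebra generated by $D_{i,r}^{\pm1},\mathsf w_{i,r}^{\pm1/2},(\mathsf w_{i,r}-v^m\mathsf w_{i,s})^{-1},(1-v^l)^{-1}$ ($1\le i<n$, $1\le r\ne s\le a_i$, $m\in\mathbb{Z}$, $l\ne0$) with $D_{i,r}\mathsf w^{1/2}_{j,s}=v^{\delta_{ij}\delta_{rs}}\mathsf w^{1/2}_{j,s}D_{i,r}$, $D$'s commuting, $\mathsf w^{1/2}$'s commuting, obvious inverse relations; $\mathsf w_{i,r}=(\mathsf w^{1/2}_{i,r})^2$. $\mathsf Z_i(z)=\prod_{s:i_s=i}(1-v^{-i}\mathsf x_s/z)^{\gamma_s}$, $\mathsf W_j(z)=\prod_{r=1}^{a_j}(1-\mathsf w_{j,r}/z)$, $\mathsf W_{j,r}(z)=\prod_{s\ne r}(1-\mathsf w_{j,s}/z)$, $\mathsf W_0=\mathsf W_n=1$. Trigonometric Lax matrix: an $n\times n$ matrix of rational functions of $z$ with coefficients in $\widetilde{\mathcal A}^v$, $T_D(z)_{\alpha\beta}=\sum_{i=1}^{\min(\alpha,\beta)}f^D_{\alpha i}(z)g^D_i(z)e^D_{i\beta}(z)$, $e^D_{ii}=f^D_{ii}=1$, where $g^D_i(z)=\prod_{t=1}^{a_i}\mathsf w_{i,t}^{-1/2}\prod_{t=1}^{a_{i-1}}\mathsf w_{i-1,t}^{1/2}\, z^{\epsilon^\vee_i(\mu^+)}\frac{\mathsf W_i(v^{-i}z)}{\mathsf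 W_{i-1}(v^{-i-1}z)}\prod_{\mathsf x\in\mathbb{C}^\times}(1-\mathsf x/z)^{-\epsilon^\vee_i(\lambda_{\mathsf x})}$; for $i<j$: $e^D_{ij}(z)=(-1)^{i-j+1}\prod_{t=1}^{a_{j-1}}\mathsf w_{j-1,t}\prod_{k=i}^{j-2}\prod_{t=1}^{a_k}\mathsf w_{k,t}^{1/2}\prod_{t=1}^{a_{i-1}}\mathsf w_{i-1,t}^{-1/2}\sum_{r_i,\dots,r_{j-1}}\frac{\prod_{k=i}^{j-1}(v^k\mathsf w_{k,r_k})^{-\alpha^\vee_k(\mu^+)}}{1-v^i\mathsf w_{i,r_i}/z}\cdot\frac{\mathsf W_{i-1}(v^{-1}\mathsf w_{i,r_i})\prod_{k=i}^{j-2}\mathsf W_{k,r_k}(v^{-1}\mathsf w_{k+1,r_{k+1}})}{\prod_{k=i}^{j-1}\mathsf W_{k,r_k}(\mathsf w_{k,r_k})}\prod_{k=i}^{j-1}\mathsf Z_k(\mathsf w_{k,r_k})\cdot\frac{\mathsf w_{i,r_i}}{\mathsf w_{j-1,r_{j-1}}}\prod_{k=i}^{j-1}D_{k,r_k}^{-1}$; $f^D_{ji}(z)=(-1)^{i-j+1}v^{i-j}\prod_{k=i+1}^j\prod_{t=1}^{a_k}\mathsf w_{k,t}^{-1/2}\sum_{r_i,\dots,r_{j-1}}\frac{1}{1-z/(v^{i+2}\mathsf w_{i,r_i})}\cdot\frac{\mathsf W_j(v\mathsf w_{j-1,r_{j-1}})\prod_{k=i+1}^{j-1}\mathsf W_{k,r_k}(v\mathsf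 w_{k-1,r_{k-1}})}{\prod_{k=i}^{j-1}\mathsf W_{k,r_k}(\mathsf w_{k,r_k})}\cdot\frac{\mathsf w_{j-1,r_{j-1}}}{\mathsf w_{i,r_i}}\prod_{k=i}^{j-1}D_{k,r_k}$ (sums over $1\le r_k\le a_k$). *)

(* Defs.v *)
From mathcomp Require Import all_boot all_algebra.
From mathcomp Require Import Rstruct complex.
From mathcomp Require Import mpoly.
From Stdlib Require Rdefinitions.

Set Implicit Arguments.
Unset Strict Implicit.
Unset Printing Implicit Defensive.

Import GRing.Theory Num.Theory.
Local Open Scope ring_scope.

Definition Cx : fieldType := complex Rdefinitions.R.

Section TrigLax.

Variables (n N : nat) (ii : 'I_N -> nat) (xx : 'I_N -> Cx) (gam : 'I_N -> int)
  (mup mum : nat -> int) (a : nat -> nat).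

Definition aa (k : nat) : nat := if (0 < k < n)%N then a k else 0%N.

Definition nvar : nat := (\sum_(1 <= k < n) aa k).+2.

Local Notation K := {fraction {mpoly Cx[nvar]}}.

Definition Kz : K := tofrac 'X_(@ord0 (\sum_(1 <= k < n) aa k).+1).
Definition Kv : K := tofrac 'X_(@inord (\sum_(1 <= k < n) aa k).+1 1).
Definition vidx (i r : nat) : nat := (2 + \sum_(1 <= k < i) aa k + (r - 1))%N.
Definition validx (i r : nat) : bool := (0 < i < n)%N && (0 < r <= aa i)%N.
Definition Uvar (i r : nat) : K :=
  if validx i r then tofrac 'X_(@inord (\sum_(1 <= k < n) aa k).+1 (vidx i r)) else 0.
Definition cst (c : Cx) : K := tofrac c%:MP.


(* eps^vee_j(varpi_i) for varpi_i = - sum_{j > i} eps_j *)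
Definition epsv_varpi (j i : nat) : int := if (i < j)%N then -1 else 0.
(* eps^vee_j(alpha_i) for alpha_i = eps_i - eps_{i+1} *)
Definition epsv_alpha (j i : nat) : int := (j == i)%:Z - (j == i.+1)%:Z.
(* alpha^vee_i(nu) for nu given by its coordinates nu_1..nu_n *)
Definition alphav (i : nat) (nu : nat -> int) : int := nu i - nu i.+1.
Definition lam (j : nat) : int := \sum_(s < N) gam s * epsv_varpi j (ii s).
Definition lamx (y : Cx) (j : nat) : int :=
  \sum_(s < N | xx s == y) gam s * epsv_varpi j (ii s).

(* ---------- the data of the Lax matrix, as functions of the values U i r
   assigned to the generators w_{i,r}^{1/2} (needed to express the twisting
   D_{i,r} f(w^{1/2}) = f(..., v w_{i,r}^{1/2}, ...) D_{i,r}) ---------- *)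
Definition Assign := nat -> nat -> K.

Definition wv (U : Assign) (i r : nat) : K := U i r ^+ 2.
Definition Wf (U : Assign) (j : nat) (y : K) : K :=
  \prod_(1 <= r < (aa j).+1) (1 - wv U j r / y).
Definition Wr (U : Assign) (j r : nat) (y : K) : K :=
  \prod_(1 <= s < (aa j).+1 | s != r) (1 - wv U j s / y).
Definition Zf (i : nat) (y : K) : K :=
  \prod_(s < N | ii s == i) (1 - Kv ^- i * cst (xx s) / y) ^ gam s.

Definition gD (U : Assign) (i : nat) : K :=
  (\prod_(1 <= t < (aa i).+1) (U i t)^-1) * (\prod_(1 <= t < (aa i.-1).+1) U i.-1 t)
  * Kz ^ mup i * (Wf U i (Kv ^- i * Kz) / Wf U i.-1 (Kv ^- i.+1 * Kz))
  * \prod_(y <- undup [seq xx s | s <- enum 'I_N]) (1 - cst y / Kz) ^ (- lamx y i).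

Fixpoint tuples (bs : seq nat) : seq (seq nat) :=
  if bs is b :: bs' then [seq r :: t | r <- iota 1 b, t <- tuples bs'] else [:: [::]].
Definition rtup (i j : nat) : seq (seq nat) := tuples [seq aa k | k <- iota i (j - i)].
Definition rk (t : seq nat) (i k : nat) : nat := nth 0%N t (k - i).

(* exponent vectors of monomials prod D_{k,r}^{e k r} *)
Definition Expo := nat -> nat -> int.
(* a formal term  c(U) * prod D^{e}, c being a coefficient in the field K *)
Definition Term : Type := ((Assign -> K) * Expo)%type.
Definition expo0 : Expo := fun _ _ => 0.
Definition expD (i : nat) (t : seq nat) (sg : int) : Expo :=
  fun k r => if (i <= k < i + size t)%N && (r == rk t i k) then sg else 0.
(* D^e f(U) = f(shift e U) D^e, since D_{k,r} w_{k,r}^{1/2} = v w_{k,r}^{1/2} D_{k,r} *)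
Definition shift (e : Expo) (U : Assign) : Assign := fun k r => Kv ^ e k r * U k r.
Definition tmul (L1 L2 : seq Term) : seq Term :=
  [seq ((fun U => t1.1 U * t2.1 (shift t1.2 U)), (fun k r => t1.2 k r + t2.2 k r))
  | t1 <- L1, t2 <- L2].

Definition ecoef (U : Assign) (i j : nat) (t : seq nat) : K :=
  let r := rk t i in
  (-1) ^ ((i : int) - (j : int) + 1) * (\prod_(1 <= s < (aa j.-1).+1) wv U j.-1 s)
  * (\prod_(i <= k < j.-1) \prod_(1 <= s < (aa k).+1) U k s)
  * (\prod_(1 <= s < (aa i.-1).+1) (U i.-1 s)^-1)
  * ((\prod_(i <= k < j) (Kv ^+ k * wv U k (r k)) ^ (- alphav k mup))
     / (1 - Kv ^+ i * wv U i (r i) / Kz)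
     * ((Wf U i.-1 (Kv ^-1 * wv U i (r i))
         * \prod_(i <= k < j.-1) Wr U k (r k) (Kv ^-1 * wv U k.+1 (r k.+1)))
        / \prod_(i <= k < j) Wr U k (r k) (wv U k (r k)))
     * (\prod_(i <= k < j) Zf k (wv U k (r k)))
     * (wv U i (r i) / wv U j.-1 (r j.-1))).

Definition fcoef (U : Assign) (j i : nat) (t : seq nat) : K :=
  let r := rk t i in
  (-1) ^ ((i : int) - (j : int) + 1) * Kv ^ ((i : int) - (j : int))
  * (\prod_(i.+1 <= k < j.+1) \prod_(1 <= s < (aa k).+1) (U k s)^-1)
  * ((1 - Kz / (Kv ^+ i.+2 * wv U i (r i)))^-1
     * ((Wf U j (Kv * wv U j.-1 (r j.-1))
         * \prod_(i.+1 <= k < j) Wr U k (r k) (Kv * wv U k.-1 (r k.-1)))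
        / \prod_(i <= k < j) Wr U k (r k) (wv U k (r k)))
     * (wv U j.-1 (r j.-1) / wv U i (r i))).

Definition one_term : seq Term := [:: ((fun _ => 1), expo0)].

Definition eD (i j : nat) : seq Term :=
  if i == j then one_term
  else if (i < j)%N then [seq ((fun U => ecoef U i j t), expD i t (-1)) | t <- rtup i j]
  else [::].
Definition fD (j i : nat) : seq Term :=
  if i == j then one_term
  else if (i < j)%N then [seq ((fun U => fcoef U j i t), expD i t 1) | t <- rtup i j]
  else [::].
Definition gDt (i : nat) : seq Term := [:: ((fun U => gD U i), expo0)].

Definition TD (al be : nat) : seq Term :=
  flatten [seq tmul (tmul (fD al i) (gDt i)) (eD i be) | i <- iota 1 (minn al be)].

Definition sTD (al be : nat) : seq Term :=
  tmul [:: ((fun _ => Kz ^ (lam 1 + mum 1) * (Zf 0 Kz)^-1), expo0)] (TD al be).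

Definition expeq (e1 e2 : Expo) : bool :=
  all (fun k => all (fun r => e1 k r == e2 k r) (iota 1 (aa k))) (iota 1 n.-1).
Definition coefAt (L : seq Term) (e : Expo) : K :=
  \sum_(t <- L | expeq t.2 e) t.1 Uvar.

(* ---------- the commutative subalgebra R of \tilde A^v generated (over C[v,v^-1]) by
   w^{+-1/2}, (w_{i,r} - v^m w_{i,s})^{-1}, (1 - v^l)^{-1}, as a subring of K ---------- *)
Definition isgen (g : K) : Prop :=
  g = Kv
  \/ (exists i r, validx i r /\ g = Uvar i r)
  \/ (exists i r s (m : int), [/\ validx i r, validx i s, r != s &
         g = wv Uvar i r - Kv ^ m * wv Uvar i s])
  \/ (exists l : int, l != 0 /\ g = 1 - Kv ^ l).

Definition no_z (p : {mpoly Cx[nvar]}) : Prop :=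
  forall m : 'X_{1..nvar}, m \in msupp p -> m ord0 = 0%N.

Definition inR (y : K) : Prop :=
  exists (p : {mpoly Cx[nvar]}) (gs : seq K),
    [/\ no_z p, (forall g, g \in gs -> isgen g) & y * \prod_(g <- gs) g = tofrac p].

Definition inRz (y : K) : Prop :=
  exists rs : seq K, (forall r, r \in rs -> inR r) /\ y = \sum_(k < size rs) rs`_k * Kz ^+ k.

(* an element sum_e c_e D^e (c_e in K) lies in \tilde A^v[z] iff every c_e is in R[z] *)
Definition in_Az (L : seq Term) : Prop := forall e : Expo, inRz (coefAt L e).

Definition dominant (nu : nat -> int) : Prop := forall i, (1 <= i < n)%N -> 0 <= alphav i nu.

Definition integrality : Prop :=
  forall j, (1 <= j <= n)%N ->
    lam j + mup j + mum j = \sum_(1 <= i < n) (a i)%:Z * epsv_alpha j i.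

Definition trig_divisor : Prop :=
  (forall s, (ii s < n)%N) /\
  (forall s, xx s != 0) /\
  (forall s, ii s != 0%N -> gam s = 1) /\
  (forall s, gam s = 1 \/ gam s = -1) /\
  dominant mup /\ dominant mum.
End TrigLax.

(* Main.v *)
Require Import Defs.
From mathcomp Require Import all_boot all_order all_algebra.
From mathcomp Require Import Rstruct complex.
From mathcomp Require Import mpoly.
From mathcomp Require Import zify ring.
From Stdlib Require Import FunctionalExtensionality.

(** The entry [(al, be)] is the sum over [i <= min al be] and over tuples [tf], [te]
    of the monomial terms of [f_{al,i} g_i e_{i,be}].  Conjugating [g_i] and [e_{i,be}]
    by the [D]'s of [f_{al,i}] replaces [w_{i,r}] by [v^2 w_{i,r}] for [r] the head of
    [tf]; the zeros of [g_i] then cancel the poles of [f] and [e], except for a simple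
    pole at [z = v^{i+2} w_{i,r}] when [tf] and [te] both start with [r].  The only
    other poles are those of [1/W_{i-1}], at the points [v^{i+1} w_{i-1,t}].  Hence the
    pole at [v^{i+2} w_{i,r}] occurs in the terms [(i, r :: tf, r :: te)] and
    [(i+1, tf, te)], which carry the same monomial in the [D]'s, and their two residues
    are opposite: no summation over tuples is needed.  Since the poles are pairwise
    distinct elements of the coefficient ring and the linear factors are monic, the
    common numerator is divisible by all of them inside that ring.  At [z = 0] the
    exponent of the [i]-th term is at least [eps_1(mu^-) - eps_i(mu^-) >= 0], by
    integrality and dominance. *)

Set Implicit Arguments.
Unset Strict Implicit.
Unset Printing Implicit Defensive.

Import Order.TTheory GRing.Theory Num.Theory.
Local Open Scope ring_scope.

(** * Sums of fractions with cancelling poles *)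

Section PolesOverSubring.

Variables (F : fieldType) (S : F -> Prop).
Hypothesis S0 : S 0.
Hypothesis S1 : S 1.
Hypothesis SN : forall x, S x -> S (- x).
Hypothesis SD : forall x y, S x -> S y -> S (x + y).
Hypothesis SM : forall x y, S x -> S y -> S (x * y).

Definition coefs_in (P : {poly F}) : Prop := forall k, S P`_k.

Lemma coefs_inC c : S c -> coefs_in c%:P.
Proof. by move=> Sc k; rewrite coefC; case: eqP. Qed.

Lemma coefs_inX : coefs_in 'X.
Proof. by move=> k; rewrite coefX; case: eqP. Qed.

Lemma coefs_inD P Q : coefs_in P -> coefs_in Q -> coefs_in (P + Q).
Proof. by move=> SP SQ k; rewrite coefD; apply: SD. Qed.

Lemma coefs_inM P Q : coefs_in P -> coefs_in Q -> coefs_in (P * Q).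
Proof.
move=> SP SQ k; rewrite coefM.
by elim/big_ind: _ => // i _; apply: SM.
Qed.

Lemma coefs_inXsubC c : S c -> coefs_in ('X - c%:P).
Proof.
by move=> Sc; apply: coefs_inD coefs_inX _; rewrite -polyCN; apply/coefs_inC/SN.
Qed.

Lemma coefs_in_prod (I : eqType) (r : seq I) (P : pred I) (G : I -> {poly F}) :
  (forall i, i \in r -> P i -> coefs_in (G i)) -> coefs_in (\prod_(i <- r | P i) G i).
Proof.
move=> SG; rewrite big_seq_cond; elim/big_rec: _ => [|i Q /andP[ri Pi] SQ].
  exact: coefs_inC.
by apply: coefs_inM SQ; apply: SG.
Qed.

Lemma coefs_in_exp P m : coefs_in P -> coefs_in (P ^+ m).
Proof.
move=> SP; elim: m => [|m IH]; first exact: coefs_inC.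
by rewrite exprS; apply: coefs_inM.
Qed.

(** Synthetic division by a monic linear factor uses ring operations only, so the quotient keeps its
    coefficients in [S]. *)
Lemma divide_XsubC P c : coefs_in P -> S c ->
  exists2 Q, coefs_in Q & P = Q * ('X - c%:P) + P.[c]%:P.
Proof.
move=> SP Sc; elim/poly_ind: P SP => [|P d IH] SP.
  by exists 0; rewrite ?horner0 ?mul0r ?add0r.
have SP' : coefs_in P.
  by move=> k; have := SP k.+1; rewrite coefD coefMX coefC /= addr0.
have [Q SQ PE] := IH SP'.
have SPc : S P.[c].
  rewrite horner_coef; elim/big_ind: _ => // k _; apply: SM => //.
  by elim: {k}(k : nat) => [|k Sck] //; rewrite exprS; apply: SM.
exists (Q * 'X + P.[c]%:P).
  by apply: coefs_inD (coefs_inC SPc); apply: coefs_inM coefs_inX.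
rewrite hornerMXaddC {1}PE !polyCD polyCM; ring.
Qed.

(** A root [d] other than [c] passes to the quotient by ['X - c%:P] because [d - c] is nonzero in
    the field [F]; it may well be a non-unit of [S]. *)
Lemma divide_prod_XsubC (P : {poly F}) (s : seq F) :
    coefs_in P -> uniq s -> (forall c, c \in s -> S c) -> (forall c, c \in s -> P.[c] = 0) ->
  exists2 Q, coefs_in Q & P = Q * \prod_(c <- s) ('X - c%:P).
Proof.
elim: s P => [|c s IH] P SP /=; first by exists P; rewrite // big_nil mulr1.
case/andP=> cs us Ss Ps.
have [Q SQ PE] := divide_XsubC SP (Ss c (mem_head _ _)).
rewrite (Ps c (mem_head _ _)) addr0 in PE.
have [||Q' SQ' QE] := IH Q SQ us.
- by move=> d ds; apply: Ss; rewrite inE ds orbT.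
- move=> d ds; have := Ps d; rewrite inE ds orbT PE !hornerE => /(_ isT)/eqP.
  rewrite mulf_eq0 subr_eq0 => /orP[/eqP //|/eqP dc].
  by rewrite -dc ds in cs.
by exists Q' => //; rewrite big_cons PE {1}QE; ring.
Qed.

(* The residue condition makes the common numerator vanish at every [q j]. *)
Lemma sum_of_cancelling_poles (I : eqType) (q : I -> F) (Qs : seq I) (z : F)
    (T : eqType) (L : seq T) (A : T -> {poly F}) (D : T -> seq I) :
    uniq Qs -> {in Qs &, injective q} -> (forall j, j \in Qs -> S (q j)) ->
    (forall j, j \in Qs -> z != q j) ->
    (forall t, t \in L -> coefs_in (A t)) ->
    (forall t, t \in L -> uniq (D t) /\ {subset D t <= Qs}) ->
    (forall j, j \in Qs -> \sum_(t <- L | j \in D t)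
       (A t).[q j] / \prod_(k <- D t | k != j) (q j - q k) = 0) ->
  exists2 P, coefs_in P &
    \sum_(t <- L) (A t).[z] / \prod_(k <- D t) (z - q k) = P.[z].
Proof.
move=> uQ qI Sq zq SA uD res0.
(* [N t] is the numerator of the term [t] over the common denominator, the product of the [z - q k]
   over all of [Qs]. *)
pose N t := A t * \prod_(k <- Qs | k \notin D t) ('X - (q k)%:P).
have SN' : coefs_in (\sum_(t <- L) N t).
  rewrite big_seq; elim/big_ind: _ => [||t tL].
  - by rewrite -[0]/(0%:P); apply: coefs_inC.
  - exact: coefs_inD.
  - apply: coefs_inM; first exact: SA.
    by apply: coefs_in_prod => k kQ _; apply/coefs_inXsubC/Sq.
have splitD t x (p : pred I) : t \in L -> \prod_(k <- Qs | p k) (x - q k) =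
    \prod_(k <- D t | p k) (x - q k) * \prod_(k <- Qs | p k && (k \notin D t)) (x - q k).
  move=> tL; have [uDt sDt] := uD t tL.
  rewrite (bigID (mem (D t))) /=; congr (_ * _).
  rewrite -[LHS]big_filter -[RHS]big_filter; apply: perm_big.
  apply: uniq_perm; rewrite ?filter_uniq // => k; rewrite !mem_filter.
  case: (p k) => //=.
  by have [kD|] := boolP (k \in D t) => //=; rewrite sDt.
have hN t x : (N t).[x] = (A t).[x] * \prod_(k <- Qs | k \notin D t) (x - q k).
  rewrite hornerM horner_prod; congr (_ * _).
  by apply: eq_bigr => k _; rewrite !hornerE.
have [||| P SP PE] := @divide_prod_XsubC (\sum_(t <- L) N t) [seq q k | k <- Qs] SN'.
- by rewrite map_inj_in_uniq.
- by move=> c /mapP[j jQ ->]; apply: Sq.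
- move=> c /mapP[j jQ ->]; rewrite horner_sum.
  (* Multiplied by the factors of all poles other than [q j], the residue condition says that the
     common numerator vanishes at [q j]. *)
  have := congr1 (fun x => x * \prod_(k <- Qs | k != j) (q j - q k)) (res0 j jQ).
  rewrite mul0r mulr_suml; apply: etrans; rewrite [LHS](bigID (fun t => j \in D t)) /=.
  (* A term without a pole at [q j] has the factor ['X - (q j)%:P] in [N t]. *)
  rewrite [X in _ + X]big1 ?addr0 => [|t jDt]; last first.
    apply/eqP; rewrite hN mulf_eq0 prodf_seq_eq0; apply/orP; right.
    by apply/hasP; exists j; rewrite // jDt subrr eqxx.
  rewrite big_seq_cond [RHS]big_seq_cond; apply: eq_bigr => t /andP[tL jDt].
  rewrite hN (splitD t _ (fun k => k != j) tL).
  have Dn0 : \prod_(k <- D t | k != j) (q j - q k) != 0.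
    rewrite prodf_seq_neq0; apply/allP => k kD; apply/implyP => kj.
    rewrite subr_eq0; apply: contra_neq kj => /qI -> //.
    by case: (uD t tL) => _; apply.
  rewrite -!mulrA; congr (_ * _); rewrite mulKf //; apply: eq_bigl => k.
  by case: (k =P j) => //= ->; rewrite jDt.
exists P => //.
have Qn0 : \prod_(k <- Qs) (z - q k) != 0.
  by rewrite prodf_seq_neq0; apply/allP => k kQ /=; rewrite subr_eq0 zq.
apply: (mulIf Qn0); have := congr1 (fun R => R.[z]) PE.
rewrite hornerM big_map horner_prod horner_sum.
have -> : \prod_(k <- Qs) ('X - (q k)%:P).[z] = \prod_(k <- Qs) (z - q k).
  by apply: eq_bigr => k _; rewrite !hornerE.
move=> <-; rewrite mulr_suml [LHS]big_seq [RHS]big_seq; apply: eq_bigr => t tL.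
have Dn0 : \prod_(k <- D t) (z - q k) != 0.
  rewrite prodf_seq_neq0; apply/allP => k kD /=.
  by rewrite subr_eq0 zq //; case: (uD t tL) => _; apply.
by rewrite hN (splitD t _ xpredT tL) -!mulrA mulKf.
Qed.

End PolesOverSubring.

(** * The coefficient ring *)

(** With [m] the minimum of two exponents, this turns an identity of Laurent monomials into one of
    monomials. *)
Lemma expf_abs_sub (F : fieldType) (x : F) (k m : int) : x != 0 -> m <= k ->
  x ^+ `|k - m|%N = x ^ (- m) * x ^ k.
Proof.
move=> x0 h; rewrite -expfzDr // [- m + k]addrC exprnP; congr (x ^ _).
by rewrite gez0_abs ?subr_ge0.
Qed.

Lemma clear_expVn (F : fieldType) (x y u : F) k : x != 0 ->
  (y - x ^- k * u) * x ^+ k = x ^+ k * y - u.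
Proof. by move=> x0; rewrite mulrBl mulrC mulrAC mulVf ?mul1r // expf_neq0. Qed.

Lemma one_sub_ratioV (F : fieldType) (x y u : F) : x != 0 ->
  (1 - u * (y / x))^-1 = (x - u * y)^-1 * x.
Proof.
move=> x0; have -> : x - u * y = x * (1 - u * (y / x)).
  by rewrite mulrBr mulr1 mulrCA [x * _]mulrC divfK.
by rewrite invfM mulrAC mulVf ?mul1r.
Qed.

Section CoefficientRing.

Variables (n : nat) (a : nat -> nat).

Local Notation nv := (nvar n a).
Local Notation P := {mpoly Cx[nv]}.
Local Notation K := {fraction P}.
Local Notation Kz := (Kz n a).
Local Notation Kv := (Kv n a).
Local Notation Uvar := (Uvar n a).
Local Notation validx := (validx n a).
Local Notation inR := (@inR n a).

(** * Independence of the variables *)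

Definition Kv_idx : 'I_nv := inord 1.
Definition Uvar_idx (i r : nat) : 'I_nv := inord (vidx n a i r).

Lemma vidx_lt i r : validx i r -> (vidx n a i r < nv)%N.
Proof.
case/andP=> /andP[i0 iN] /andP[r0 ra]; rewrite /vidx /nvar.
have -> : (\sum_(1 <= k < n) aa n a k =
    \sum_(1 <= k < i) aa n a k + aa n a i + \sum_(i.+1 <= k < n) aa n a k)%N.
  by rewrite (big_cat_nat (n := i)) ?(ltnW iN) //= (big_ltn iN) addnA.
lia.
Qed.

(** The variables of each layer fill a block of consecutive indices, and the blocks follow the order
    of the layers. *)
Lemma vidx_lt_layer i j r s : validx i r -> validx j s -> (i < j)%N ->
  (vidx n a i r < vidx n a j s)%N.
Proof.
case/andP=> /andP[i0 iN] /andP[r0 ra] /andP[/andP[j0 jN] /andP[s0 sa]] ij; rewrite /vidx.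
have -> : (\sum_(1 <= k < j) aa n a k =
    \sum_(1 <= k < i) aa n a k + aa n a i + \sum_(i.+1 <= k < j) aa n a k)%N.
  by rewrite (big_cat_nat (n := i)) ?(ltnW ij) //= (big_ltn ij) addnA.
lia.
Qed.

Lemma vidx_inj i j r s : validx i r -> validx j s -> vidx n a i r = vidx n a j s ->
  (i, r) = (j, s).
Proof.
move=> vi vj e; have [ij|ji|ij] := ltngtP i j.
- by have := vidx_lt_layer vi vj ij; rewrite e ltnn.
- by have := vidx_lt_layer vj vi ji; rewrite e ltnn.
- subst j; congr (_, _); move: vi vj e; rewrite /Defs.validx /vidx; lia.
Qed.

Lemma Kv_idx_neq0 : Kv_idx != ord0.
Proof. by rewrite -val_eqE /= inordK. Qed.

Lemma val_Uvar_idx i r : validx i r -> Uvar_idx i r = vidx n a i r :> nat.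
Proof. by move=> v; rewrite inordK //; apply: vidx_lt. Qed.

Lemma Uvar_idx_neq0 i r : validx i r -> Uvar_idx i r != ord0.
Proof. by move=> v; rewrite -val_eqE /= val_Uvar_idx // /vidx; lia. Qed.

Lemma Uvar_idx_neqv i r : validx i r -> Uvar_idx i r != Kv_idx.
Proof. by move=> v; rewrite -val_eqE /= val_Uvar_idx // inordK // /vidx; lia. Qed.

Lemma Uvar_idx_inj i j r s : validx i r -> validx j s -> Uvar_idx i r = Uvar_idx j s ->
  (i, r) = (j, s).
Proof.
move=> vi vj /(congr1 (@nat_of_ord _)); rewrite !val_Uvar_idx //.
exact: vidx_inj.
Qed.

Lemma UvarE i r : validx i r -> Uvar i r = tofrac ('X_(Uvar_idx i r) : P).
Proof. by rewrite /Defs.Uvar => ->. Qed.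

Lemma KvE : Kv = tofrac ('X_Kv_idx : P). Proof. by []. Qed.

Lemma KzE : Kz = tofrac ('X_(@ord0 (\sum_(1 <= k < n) aa n a k).+1) : P).
Proof. by []. Qed.

Lemma tofracX_neq0 (m : 'X_{1..nv}) : tofrac ('X_[m] : P) != 0.
Proof. by rewrite tofrac_eq0 -msupp_eq0 msuppX. Qed.

Lemma Kv_neq0 : Kv != 0. Proof. exact: tofracX_neq0. Qed.

Lemma Kz_neq0 : Kz != 0. Proof. exact: tofracX_neq0. Qed.

Lemma Uvar_neq0 i r : validx i r -> Uvar i r != 0.
Proof. by move/UvarE->; apply: tofracX_neq0. Qed.

Lemma tofracX_inj : injective (fun m : 'X_{1..nv} => tofrac ('X_[m] : P)).
Proof.
move=> m m' /eqP; rewrite tofrac_eq => /eqP e.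
by apply/(mem_msuppXP Cx); rewrite e msuppX mem_head.
Qed.

Lemma Kv_exp_wv i r k : validx i r ->
  Kv ^+ k * wv Uvar i r = tofrac ('X_[(U_(Kv_idx) *+ k + U_(Uvar_idx i r) *+ 2)] : P).
Proof.
by move=> v; rewrite /wv UvarE // KvE -!tofracXn -tofracM !mpolyXn mpolyXD.
Qed.

(** After multiplication by a power of [v] both sides are monomials. The left one has exponent 2 in
    [w_{i,r}^{1/2}]; the right one has exponent 0 there unless the two variables coincide. *)
Lemma exp_wv_inj i j r s (k l : int) : validx i r -> validx j s ->
  Kv ^ k * wv Uvar i r = Kv ^ l * wv Uvar j s -> (i, r) = (j, s).
Proof.
move=> vi vj e.
have {e} : Kv ^+ `|k - Num.min k l|%N * wv Uvar i r = Kv ^+ `|l - Num.min k l|%N * wv Uvar j s.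
  by rewrite !expf_abs_sub ?Kv_neq0 ?ge_min ?lexx ?orbT // -!mulrA e.
rewrite !Kv_exp_wv // => /tofracX_inj /(congr1 (fun m : 'X_{1..nv} => m (Uvar_idx i r))).
rewrite !mnmDE !mulmnE !mnm1E eqxx ![Kv_idx == _]eq_sym (negPf (Uvar_idx_neqv vi)) /=.
by case: eqP => // e _; apply/esym/Uvar_idx_inj.
Qed.

Lemma Kz_neq_exp_wv i r (k : int) : validx i r -> Kz != Kv ^ k * wv Uvar i r.
Proof.
move=> v; apply/eqP => e.
have {e} : Kv ^+ `|k - Num.min k 0|%N * wv Uvar i r = Kv ^+ `|Num.min k 0|%N * Kz.
  have -> : `|Num.min k 0|%N = `|0 - Num.min k 0|%N by rewrite sub0r abszN.
  by rewrite !expf_abs_sub ?Kv_neq0 ?ge_min ?lexx ?orbT // -!mulrA e expr0z mul1r.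
rewrite !Kv_exp_wv // KvE KzE -tofracXn -tofracM mpolyXn -mpolyXD => /tofracX_inj.
move/(congr1 (fun m : 'X_{1..nv} => m (Uvar_idx i r))).
rewrite !mnmDE !mulmnE !mnm1E eqxx ![Kv_idx == _]eq_sym (negPf (Uvar_idx_neqv v)).
by rewrite eq_sym (negPf (Uvar_idx_neq0 v)).
Qed.

(** * Numerators free of [z] *)

Lemma no_zC c : @no_z n a c%:MP.
Proof. by move=> m; rewrite msuppC; case: eqP => // _; rewrite inE => /eqP->; rewrite mnm0E. Qed.

Lemma Kz_neq_cst c : Kz != cst n a c.
Proof.
rewrite KzE tofrac_eq; apply/eqP => e.
by have := @no_zC c U_(ord0)%MM; rewrite -e msuppX mem_head mnm1E eqxx => /(_ isT).
Qed.

Lemma no_zX (i : 'I_nv) : i != ord0 -> no_z ('X_i : P).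
Proof. by move=> i0 m; rewrite msuppX inE => /eqP->; rewrite mnm1E (negPf i0). Qed.

Lemma no_zN (p : P) : no_z p -> no_z (- p).
Proof. by move=> zp m; rewrite (perm_mem (msuppN p)); apply: zp. Qed.

Lemma no_zD (p q : P) : no_z p -> no_z q -> no_z (p + q).
Proof.
move=> zp zq m /msuppD_le; rewrite mem_cat => /orP[]; [exact: zp | exact: zq].
Qed.

Lemma no_zM (p q : P) : no_z p -> no_z q -> no_z (p * q).
Proof.
move=> zp zq m /msuppM_le /allpairsP[[m1 m2] /= [m1p m2q ->]].
by rewrite mnmDE zp // zq.
Qed.

Lemma no_z_exp (p : P) k : no_z p -> no_z (p ^+ k).
Proof.
move=> zp; elim: k => [|k IH]; first by rewrite expr0 -[1]/(1%:MP); apply: no_zC.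
by rewrite exprS; apply: no_zM.
Qed.

(* Generators may contain negative powers of v, hence the extra factor. *)
Lemma isgen_numerator (g : K) : isgen g ->
  exists k (p : P), no_z p /\ g * Kv ^+ k = tofrac p.
Proof.
have zv : no_z ('X_Kv_idx : P) by apply/no_zX/Kv_idx_neq0.
have zu i r : validx i r -> no_z ('X_(Uvar_idx i r) : P).
  by move=> v; apply/no_zX/Uvar_idx_neq0.
have v0 := Kv_neq0.
case=> [->|[[i [r [vi ->]]]|[[i [r [s [m [vr vs _ ->]]]]]|[l [_ ->]]]]].
- by exists 0, 'X_Kv_idx; rewrite expr0 mulr1.
- by exists 0, 'X_(Uvar_idx i r); rewrite expr0 mulr1 UvarE //; split=> //; apply: zu.
- case: m => m.
    exists 0, ('X_(Uvar_idx i r) ^+ 2 - 'X_Kv_idx ^+ m * 'X_(Uvar_idx i s) ^+ 2); split.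
      apply/no_zD/no_zN/no_zM; do ?apply: no_z_exp => //; exact: zu.
    by rewrite expr0 mulr1 /wv !UvarE // KvE !(tofracXn, tofracM, tofracB).
  exists m.+1, ('X_Kv_idx ^+ m.+1 * 'X_(Uvar_idx i r) ^+ 2 - 'X_(Uvar_idx i s) ^+ 2); split.
    apply: no_zD; [apply: no_zM|apply: no_zN]; do ?apply: no_z_exp => //; exact: zu.
  rewrite /wv !UvarE // KvE tofracB tofracM !tofracXn NegzE -exprnN.
  exact: clear_expVn.
- case: l => l.
    exists 0, (1 - 'X_Kv_idx ^+ l); split.
      apply/no_zD/no_zN/no_z_exp => //; exact: no_zC.
    by rewrite expr0 mulr1 tofracB tofracXn tofrac1.
  exists l.+1, ('X_Kv_idx ^+ l.+1 - 1); split.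
    by apply: no_zD; [exact: no_z_exp|apply: no_zN; exact: no_zC].
  rewrite tofracB tofracXn tofrac1 NegzE -exprnN.
  by have := clear_expVn 1 1 l.+1 Kv_neq0; rewrite !mulr1.
Qed.

Lemma isgen_prod_numerator (gs : seq K) : (forall g, g \in gs -> isgen g) ->
  exists k (p : P), no_z p /\ (\prod_(g <- gs) g) * Kv ^+ k = tofrac p.
Proof.
elim: gs => [|g gs IH] G.
  by exists 0, 1; rewrite big_nil mulr1 tofrac1; split=> //; apply: no_zC.
have [|k [p [zp e]]] := IH; first by move=> h hs; apply: G; rewrite inE hs orbT.
have [|l [q [zq eq]]] := @isgen_numerator g; first by apply: G; rewrite mem_head.
exists (k + l)%N, (p * q); split; first exact: no_zM.
by rewrite tofracM -e -eq big_cons exprD; ring.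
Qed.

(** * Closure properties of the coefficient ring *)

Lemma Kv_gen : isgen Kv. Proof. by left. Qed.

Lemma nseq_gen k (g : K) : g \in nseq k Kv -> isgen g.
Proof. by rewrite mem_nseq => /andP[_ /eqP->]; apply: Kv_gen. Qed.

Lemma inR_tofrac (p : P) : no_z p -> inR (tofrac p).
Proof. by move=> zp; exists p, [::]; rewrite big_nil mulr1. Qed.

Lemma inR_cst c : inR (cst n a c).
Proof. by apply: inR_tofrac; apply: no_zC. Qed.

Lemma inR0 : inR 0. Proof. by rewrite -tofrac0; apply/inR_tofrac/no_zC. Qed.

Lemma inR1 : inR 1. Proof. by rewrite -tofrac1; apply/inR_tofrac/no_zC. Qed.

Lemma inRN x : inR x -> inR (- x).
Proof.
case=> p [gs [zp G e]]; exists (- p), gs; split=> //; first exact: no_zN.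
by rewrite tofracN -e mulNr.
Qed.

Lemma inRM x y : inR x -> inR y -> inR (x * y).
Proof.
case=> p [gs [zp G e]] [q [hs [zq H f]]]; exists (p * q), (gs ++ hs); split.
- exact: no_zM.
- by move=> g; rewrite mem_cat => /orP[]; [exact: G|exact: H].
- by rewrite big_cat /= tofracM -e -f; ring.
Qed.

Lemma inRD x y : inR x -> inR y -> inR (x + y).
Proof.
case=> p [gs [zp G e]] [q [hs [zq H f]]].
have [k [p' [zp' e']]] := isgen_prod_numerator G.
have [l [q' [zq' f']]] := isgen_prod_numerator H.
have zv m : no_z ('X_Kv_idx ^+ m : P) by apply/no_z_exp/no_zX/Kv_idx_neq0.
(* Over the denominator [gs ++ hs] the numerators are [p] times the product of [hs] and [q] times
   the product of [gs]. The [k + l] copies of [v] turn these products into the polynomials [q'] and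
   [p']. *)
exists (p * q' * 'X_Kv_idx ^+ k + q * p' * 'X_Kv_idx ^+ l).
exists (gs ++ hs ++ nseq (k + l) Kv); split.
- by do ?[apply: no_zD|apply: no_zM].
- move=> g; rewrite !mem_cat => /or3P[]; [exact: G|exact: H|exact: nseq_gen].
- rewrite !big_cat /= big_nseq -Monoid.iteropE /= -[iterop _ _ _ _]/(Kv ^+ (k + l)).
  by rewrite exprD tofracD !tofracM -e -f -e' -f' !tofracXn -KvE; ring.
Qed.

Lemma inR_gen g : isgen g -> inR g.
Proof.
move=> G; have [k [p [zp e]]] := isgen_numerator G.
exists p, (nseq k Kv); split=> //; first by move=> h; apply: nseq_gen.
by rewrite big_nseq -Monoid.iteropE.
Qed.

Lemma inRV_gen g : isgen g -> inR g^-1.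
Proof.
(* The convention [0^-1 = 0] settles the case of a zero generator. *)
move=> G; have [->|g0] := eqVneq g 0; first by rewrite invr0; apply: inR0.
exists 1, [:: g]; split.
- exact: no_zC.
- by move=> h; rewrite inE => /eqP->.
- by rewrite big_seq1 mulVf ?tofrac1.
Qed.

Lemma inR_exp x k : inR x -> inR (x ^+ k).
Proof.
move=> Rx; elim: k => [|k IH]; first by rewrite expr0; apply: inR1.
by rewrite exprS; apply: inRM.
Qed.

Lemma inR_expz x (k : int) : inR x -> inR x^-1 -> inR (x ^ k).
Proof. by case: k => k Rx Rx'; rewrite ?NegzE -?exprnN -?exprVn; apply: inR_exp. Qed.

Lemma inR_Kv_expz (k : int) : inR (Kv ^ k).
Proof. by apply: inR_expz; [apply: inR_gen|apply: inRV_gen]; left. Qed.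

Lemma inR_Uvar i r : inR (Uvar i r).
Proof.
case v : (validx i r); last by rewrite /Defs.Uvar v; apply: inR0.
by apply: inR_gen; right; left; exists i, r.
Qed.

Lemma inRV_Uvar i r : inR (Uvar i r)^-1.
Proof.
case v : (validx i r); last by rewrite /Defs.Uvar v invr0; apply: inR0.
by apply: inRV_gen; right; left; exists i, r.
Qed.

(** The inverse equals [w_{i,r} / (w_{i,r} - v^k w_{i,s})], whose denominator is a generator. *)
Lemma inRV_one_sub_wv i r s (k : int) : validx i r -> validx i s -> s != r ->
  inR (1 - Kv ^ k * (wv Uvar i s / wv Uvar i r))^-1.
Proof.
move=> vr vs sr.
have w0 : wv Uvar i r != 0 by apply: expf_neq0; exact: Uvar_neq0.
rewrite one_sub_ratioV //.
apply: inRM; last exact/inR_exp/inR_Uvar.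
by apply: inRV_gen; do 2!right; left; exists i, r, s, k; rewrite vr vs eq_sym sr.
Qed.

Lemma inRz_horner (p : {poly K}) : coefs_in inR p -> inRz p.[Kz].
Proof.
move=> Rp; exists (polyseq p); split; last by rewrite horner_coef.
by move=> r /(nthP 0)[k _ <-].
Qed.

End CoefficientRing.

(** * Terms of the Lax matrix over an arbitrary field *)

Lemma rk_cons r t i k : (i < k)%N -> rk (r :: t) i k = rk t i.+1 k.
Proof. by move=> ik; rewrite /rk (_ : k - i = (k - i.+1).+1)%N //; lia. Qed.

Lemma rk_head t i : rk t i i = head 0%N t.
Proof. by rewrite /rk subnn nth0. Qed.

Section LaxTerms.

Variables (F : fieldType) (v : F) (b : nat -> nat) (X : nat -> nat -> F).
Variables (al be : nat) (mu : nat -> int) (M : nat -> int) (delta : nat -> nat).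
Variables (N : nat) (ii : 'I_N -> nat) (x : 'I_N -> F).

Hypothesis v0 : v != 0.
Hypothesis X0 : forall i r, (0 < r <= b i)%N -> X i r != 0.
Hypothesis X_indep : forall i j r s (k l : int), (0 < r <= b i)%N -> (0 < s <= b j)%N ->
  v ^ k * X i r ^+ 2 = v ^ l * X j s ^+ 2 -> (i, r) = (j, s).

Implicit Types (U : nat -> nat -> F) (tf te : seq nat).

Definition w U i r := U i r ^+ 2.
Definition W U j y := \prod_(1 <= s < (b j).+1) (1 - w U j s / y).
Definition Wx U j r y := \prod_(1 <= s < (b j).+1 | s != r) (1 - w U j s / y).
Definition layer_prod U i := \prod_(1 <= s < (b i).+1) U i s.
Definition layer_prodV U i := \prod_(1 <= s < (b i).+1) (U i s)^-1.

(** Effect on the [w^{1/2}] of moving the product of the [D_{k, rk t i k}] past them; each selected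
    [w] is thus multiplied by [v^2]. *)
Definition shiftD i (t : seq nat) U : nat -> nat -> F :=
  fun k r => if (i <= k < i + size t)%N && (r == rk t i k) then v * U k r else U k r.

(** The exponents [gamma_s] are omitted: only layers [i > 0] occur, and there they equal 1. *)
Definition Z i y := \prod_(s < N | ii s == i) (1 - v ^- i * x s / y).

Definition valid_tuple i j t :=
  size t = (j - i)%N /\ forall k, (i <= k < j)%N -> (0 < rk t i k <= b k)%N.

(* [ecoef_free] and [fcoef_free] are [ecoef] and [fcoef] without their factor depending
   on [z], which is [eps] or [phi] below. *)
Definition ecoef_free U (i j : nat) t : F :=
  if i == j then 1 else
  (-1) ^ ((i : int) - (j : int) + 1) * (\prod_(1 <= s < (b j.-1).+1) w U j.-1 s)
  * (\prod_(i <= k < j.-1) layer_prod U k)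
  * layer_prodV U i.-1
  * ((\prod_(i <= k < j) (v ^+ k * w U k (rk t i k)) ^ (- alphav k mu))
     * ((W U i.-1 (v^-1 * w U i (rk t i i))
         * \prod_(i <= k < j.-1) Wx U k (rk t i k) (v^-1 * w U k.+1 (rk t i k.+1)))
        / \prod_(i <= k < j) Wx U k (rk t i k) (w U k (rk t i k)))
     * (\prod_(i <= k < j) Z k (w U k (rk t i k)))
     * (w U i (rk t i i) / w U j.-1 (rk t i j.-1))).

Definition fcoef_free U (j i : nat) t : F :=
  if i == j then 1 else
  (-1) ^ ((i : int) - (j : int) + 1) * v ^ ((i : int) - (j : int))
  * (\prod_(i.+1 <= k < j.+1) layer_prodV U k)
  * ((W U j (v * w U j.-1 (rk t i j.-1))
         * \prod_(i.+1 <= k < j) Wx U k (rk t i k) (v * w U k.-1 (rk t i k.-1)))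
        / \prod_(i <= k < j) Wx U k (rk t i k) (w U k (rk t i k))
     * (w U j.-1 (rk t i j.-1) / w U i (rk t i i))).

(** Both a pole of [f_{ji}] and a zero of [W_i(v^{-i-2} z)], the denominator of [g_{i+1}]. This
    coincidence makes consecutive levels share poles. *)
Definition pole i r := v ^+ i.+2 * w X i r.

Definition phi i t y := if (i < al)%N then (1 - y / pole i (head 0%N t))^-1 else 1.
Definition eps U i t y := if (i < be)%N then (1 - v ^+ i * w U i (head 0%N t) / y)^-1 else 1.

Lemma valid_tuple_head i j t : valid_tuple i j t -> (i < j)%N -> (0 < head 0%N t <= b i)%N.
Proof. by case=> _ h ij; rewrite -(rk_head t i); apply: h; rewrite leqnn. Qed.

Lemma valid_tuple_behead i j r t : (i < j)%N -> valid_tuple i j (r :: t) -> valid_tuple i.+1 j t.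
Proof.
move=> ij [/= s h]; split; first by lia.
by move=> k ik; rewrite -(rk_cons r) //; [apply: h|]; lia.
Qed.

Lemma shiftD_head i t U : (0 < size t)%N ->
  forall r, shiftD i t U i r = if r == head 0%N t then v * U i r else U i r.
Proof. by move=> st r; rewrite /shiftD rk_head leqnn -[X in (X < _)%N]addn0 ltn_add2l st. Qed.

Lemma shiftD_below i t U k : (k < i)%N -> shiftD i t U k =1 U k.
Proof. by move=> ki r; rewrite /shiftD leqNgt ki. Qed.

Lemma shiftD_cons i r t U k : k != i -> shiftD i (r :: t) U k =1 shiftD i.+1 t U k.
Proof.
move=> ki s; rewrite /shiftD /= addnS addSn.
have [ik|ik] := ltnP i k; last by rewrite [(i <= k)%N]leqNgt ltn_neqAle ki ik.
by rewrite (ltnW ik) rk_cons.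
Qed.

Lemma eq_w U U' i : U i =1 U' i -> w U i =1 w U' i.
Proof. by move=> e r; rewrite /w e. Qed.

Lemma eq_W U U' i y : U i =1 U' i -> W U i y = W U' i y.
Proof. by move=> e; apply: eq_bigr => r _; rewrite /w e. Qed.

Lemma eq_Wx U U' i r y : U i =1 U' i -> Wx U i r y = Wx U' i r y.
Proof. by move=> e; apply: eq_bigr => s _; rewrite /w e. Qed.

Lemma eq_layer_prod U U' i : U i =1 U' i -> layer_prod U i = layer_prod U' i.
Proof. by move=> e; apply: eq_bigr => s _; rewrite e. Qed.

Lemma eq_layer_prodV U U' i : U i =1 U' i -> layer_prodV U i = layer_prodV U' i.
Proof. by move=> e; apply: eq_bigr => s _; rewrite e. Qed.

(** The only variable of layer [i] that the shift changes is the one that [Wx] omits. *)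
Lemma Wx_shiftD i t U y : (0 < size t)%N ->
  Wx (shiftD i t U) i (head 0%N t) y = Wx U i (head 0%N t) y.
Proof.
by move=> st; apply: eq_bigr => s sr; rewrite /w shiftD_head // (negPf sr).
Qed.

Lemma layer_prodD1 U i r : (0 < r <= b i)%N ->
  layer_prod U i = U i r * \prod_(1 <= s < (b i).+1 | s != r) U i s.
Proof.
by move=> vr; rewrite /layer_prod (bigD1_seq r) ?iota_uniq // mem_index_iota ltnS.
Qed.

Lemma WD1 U i r y : (0 < r <= b i)%N -> W U i y = (1 - w U i r / y) * Wx U i r y.
Proof.
by move=> vr; rewrite /W (bigD1_seq r) ?iota_uniq // mem_index_iota ltnS.
Qed.

Lemma layer_prodVE U i : layer_prodV U i = (layer_prod U i)^-1.
Proof. by rewrite /layer_prodV prodfV. Qed.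

Lemma layer_prod_w U i : \prod_(1 <= s < (b i).+1) w U i s = layer_prod U i ^+ 2.
Proof. by rewrite /layer_prod -prodrXl. Qed.

Lemma layer_prod_shiftD i t U : (0 < size t)%N -> (0 < head 0%N t <= b i)%N ->
  layer_prod (shiftD i t U) i = v * layer_prod U i.
Proof.
move=> st vr; rewrite !(layer_prodD1 _ vr) shiftD_head // eqxx -mulrA; congr (_ * (_ * _)).
by apply: eq_bigr => s sr; rewrite shiftD_head // (negPf sr).
Qed.

Lemma layer_prod_neq0 i : layer_prod X i != 0.
Proof.
rewrite prodf_seq_neq0; apply/allP => s; rewrite mem_index_iota ltnS => vs /=.
exact: X0.
Qed.

Lemma w_neq0 k r : (0 < r <= b k)%N -> w X k r != 0.
Proof. by move=> vr; rewrite expf_neq0 ?X0. Qed.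

Lemma pole_neq0 i r : (0 < r <= b i)%N -> pole i r != 0.
Proof. by move=> vr; rewrite mulf_neq0 ?expf_neq0 ?w_neq0 ?X0. Qed.

(** The power is [1] or [v ^ 2]. As [X_indep] allows arbitrary powers of [v], it also separates
    shifted variables of distinct indices. *)
Lemma shiftD_exp i t k r : exists l : int, w (shiftD i t X) k r = v ^ l * w X k r.
Proof.
rewrite /w /shiftD; case: ifP => _; last by exists 0; rewrite expr0z mul1r.
by exists 2; rewrite exprMn.
Qed.

Lemma w_indep i j r s (k l : int) : (0 < r <= b i)%N -> (0 < s <= b j)%N -> (i, r) != (j, s) ->
  v ^ k * w X i r != v ^ l * w X j s.
Proof. by move=> vr vs; apply: contra_neq; apply: X_indep. Qed.

Lemma one_sub_ratio_neq0 i j r s (k l : int) :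
  (0 < r <= b i)%N -> (0 < s <= b j)%N -> (i, r) != (j, s) ->
  1 - (v ^ k * w X i r) / (v ^ l * w X j s) != 0.
Proof.
move=> vr vs ne; have d0 : v ^ l * w X j s != 0.
  by rewrite mulf_neq0 ?expfz_neq0 ?w_neq0.
apply: contra_neq (w_indep k l vr vs ne) => /eqP; rewrite subr_eq0 => /eqP e.
by rewrite -[RHS]mul1r e divfK.
Qed.

Lemma Wx_neq0 i r (k : int) : (0 < r <= b i)%N -> Wx X i r (v ^ k * w X i r) != 0.
Proof.
move=> vr; rewrite prodf_seq_neq0; apply/allP => s; rewrite mem_index_iota ltnS => vs.
apply/implyP => sr; rewrite -[w X i s]mul1r; apply: (one_sub_ratio_neq0 0) => //.
by rewrite xpair_eqE negb_and sr orbT.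
Qed.

Lemma W_neq0 i j r (k : int) : (0 < r <= b i)%N -> j != i -> W X j (v ^ k * w X i r) != 0.
Proof.
move=> vr ij; rewrite prodf_seq_neq0; apply/allP => s; rewrite mem_index_iota ltnS => vs /=.
rewrite -[w X j s]mul1r; apply: (one_sub_ratio_neq0 0) => //.
by rewrite xpair_eqE negb_and ij.
Qed.

(** Prepending [r] replaces [W_{i+1}] by the product without its factor at the head [r1] of [t].
    That factor times [phi i.+1 t (pole i r)] is [- v w_{i+1,r1} / w_{i,r}], which accounts for the
    change of sign, of the power of [v] and of the final quotient of [w]'s. *)
Lemma fcoef_free_step i r t (U := shiftD i.+1 t X) : (i < al)%N -> valid_tuple i al (r :: t) ->
  fcoef_free X al i (r :: t) = fcoef_free X al i.+1 t *
    (v^-1 * layer_prodV U i.+1 / Wx X i r (w X i r) * (W U i.+1 (v * w X i r) * phi i.+1 t (pole i r))).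
Proof.
move=> ial vt; have vr := valid_tuple_head vt ial; rewrite /= in vr.
have vt' := valid_tuple_behead ial vt.
have wr0 := w_neq0 vr; have Wr0 := Wx_neq0 0 vr; rewrite expr0z mul1r in Wr0.
rewrite /fcoef_free ltn_eqF // /phi; move: vt; case: eqP => [ali|ali] vt.
  (* At [al = i.+1] the tuple ends: [t] is empty, and [phi] and the remaining [fcoef_free] are both
     1. *)
  have t0 : t = [::] by apply/eqP; rewrite -size_eq0; case: vt; rewrite /= -ali; lia.
  rewrite -{}ali in vt *; rewrite ltnn /= rk_head /= big_nat1 big_geq // big_nat1 rk_head /=.
  rewrite (_ : i%:Z - i.+1%:Z = -1); last by rewrite -addn1 PoszD; ring.
  rewrite addNr expr0z exprN1 /U t0.
  have sh : shiftD i.+1 [::] X i.+1 =1 X i.+1.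
    by move=> s; rewrite /shiftD addn0 ltnn andbF.
  rewrite (eq_layer_prodV sh) (eq_W _ sh); field.
  by apply/and3P; split.
have ial' : (i.+1 < al)%N by lia.
rewrite ial'; have vr1 := valid_tuple_head vt' ial'.
have st : (0 < size t)%N by case: vt' => ->; lia.
set r1 := head 0%N t in vr1 *.
have -> : \prod_(i.+1 <= k < al.+1) layer_prodV X k =
    layer_prodV X i.+1 * \prod_(i.+2 <= k < al.+1) layer_prodV X k.
  by rewrite big_ltn.
have -> : \prod_(i.+1 <= k < al) Wx X k (rk (r :: t) i k) (v * w X k.-1 (rk (r :: t) i k.-1)) =
    Wx X i.+1 r1 (v * w X i r) *
    \prod_(i.+2 <= k < al) Wx X k (rk t i.+1 k) (v * w X k.-1 (rk t i.+1 k.-1)).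
  rewrite big_ltn //= rk_cons // !rk_head; congr (_ * _).
  by apply: eq_big_nat => k /andP[ik kj]; rewrite !rk_cons //; lia.
have -> : \prod_(i <= k < al) Wx X k (rk (r :: t) i k) (w X k (rk (r :: t) i k)) =
    Wx X i r (w X i r) * \prod_(i.+1 <= k < al) Wx X k (rk t i.+1 k) (w X k (rk t i.+1 k)).
  rewrite big_ltn // rk_head; congr (_ * _).
  by apply: eq_big_nat => k /andP[ik kj]; rewrite !rk_cons.
rewrite !rk_head /= rk_cons; last by lia.
have -> : layer_prodV U i.+1 = v^-1 * layer_prodV X i.+1.
  by rewrite !layer_prodVE layer_prod_shiftD // invfM.
have -> : W U i.+1 (v * w X i r) =
    (1 - v ^+ 2 * w X i.+1 r1 / (v * w X i r)) * Wx X i.+1 r1 (v * w X i r).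
  by rewrite (WD1 _ _ vr1) Wx_shiftD // /w /U shiftD_head // eqxx exprMn.
set P1 := \prod_(_ <= _ < _) layer_prodV _ _; set P2 := \prod_(_ <= _ < _) Wx _ _ _ _.
set P3 := \prod_(_ <= _ < _) Wx _ _ _ _.
have wr1 := w_neq0 vr1.
have ne : v * w X i.+1 r1 - w X i r != 0.
  rewrite subr_eq0 eq_sym; have := w_indep 0 1 vr vr1; rewrite expr0z mul1r; apply.
  by rewrite xpair_eqE negb_and; apply/orP; left; lia.
have -> : (i%:Z - al%:Z) = (i.+1%:Z - al%:Z) - 1 by lia.
rewrite [_ - 1 + 1]addrAC [(-1) ^ _]expfzDr ?oppr_eq0 ?oner_eq0 // [v ^ _]expfzDr //.
rewrite !exprN1 /pole [v ^+ i.+3]exprS; have vi0 : v ^+ i.+2 != 0 by rewrite expf_neq0.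
rewrite [in LHS]invfM; move: (P3^-1) => P3V; field.
by rewrite wr1 vi0 v0 ne wr0 Wr0 oppr_eq0 oner_eq0.
Qed.

(** Both tuples start with [r], so [e] sees [v^2 w_{i,r}], and [v^i] times this is [pole i r]. The
    factor of [W_i] at [r], absent on the left, combines with [eps] at the pole to
    [- v w_{i,r} / w_{i+1,r1}], where [r1] is the head of [t] and [w_{i+1,r1}] is taken in [U]. *)
Lemma ecoef_free_step i r t tf (U := shiftD i.+1 tf X) (U' := shiftD i (r :: tf) X) :
  (i < be)%N -> valid_tuple i be (r :: t) -> (0 < i)%N ->
  ecoef_free U' i be (r :: t) = ecoef_free U i.+1 be t *
    (v * layer_prod U' i * layer_prod U i * layer_prodV X i.-1
     * pole i r ^ (- alphav i mu) * Z i (v ^+ 2 * w X i r)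
     * (W X i.-1 (v * w X i r) / Wx X i r (v ^+ 2 * w X i r)) * eps U i.+1 t (pole i r)).
Proof.
move=> ibe vt i0; have vr := valid_tuple_head vt ibe; rewrite /= in vr.
have vt' := valid_tuple_behead ibe vt.
have wr0 := w_neq0 vr.
have Wr0 : Wx X i r (v ^+ 2 * w X i r) != 0 by apply: (Wx_neq0 2).
have wU' : w U' i r = v ^+ 2 * w X i r by rewrite /w /U' shiftD_head // eqxx exprMn.
have WU' y : Wx U' i r y = Wx X i r y by apply: Wx_shiftD.
have UU' k : (i < k)%N -> U' k =1 U k by move=> ik; apply: shiftD_cons; lia.
have UX : U i =1 X i by apply: shiftD_below.
have U'X : U' i.-1 =1 X i.-1 by apply: shiftD_below; lia.
have qE : v ^+ i * (v ^+ 2 * w X i r) = pole i r by rewrite mulrA -exprD addn2.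
have vw : v^-1 * (v ^+ 2 * w X i r) = v * w X i r by rewrite expr2 -mulrA mulKf.
rewrite /ecoef_free ltn_eqF // /eps; move: vt; case: eqP => [bei|bei] vt.
  rewrite -{}bei in vt *. rewrite ltnn /= !big_nat1 !(@big_geq _ _ _ i i) // !rk_head /=.
  rewrite (_ : i%:Z - i.+1%:Z = -1); last by rewrite -addn1 PoszD; ring.
  rewrite addNr expr0z WU' wU' layer_prod_w (eq_layer_prodV U'X) (eq_W _ U'X) qE vw (eq_layer_prod UX).
  have -> : layer_prod U' i = v * layer_prod X i by apply: layer_prod_shiftD.
  field.
  by rewrite Wr0 wr0 v0.
have ibe' : (i.+1 < be)%N by lia.
rewrite ibe'; have vr1 := valid_tuple_head vt' ibe'.
set r1 := head 0%N t in vr1 *.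
have [l wl] := shiftD_exp i.+1 tf i.+1 r1; rewrite -/U in wl.
have wr1 : w U i.+1 r1 != 0 by rewrite wl mulf_neq0 ?expfz_neq0 ?w_neq0.
have ne : v * w X i r - w U i.+1 r1 != 0.
  rewrite subr_eq0 wl; have := w_indep 1 l vr vr1; apply.
  by rewrite xpair_eqE negb_and; apply/orP; left; lia.
have rkc k : (i < k)%N -> rk (r :: t) i k = rk t i.+1 k by apply: rk_cons.
have -> : \prod_(i <= k < be.-1) layer_prod U' k =
    layer_prod U' i * \prod_(i.+1 <= k < be.-1) layer_prod U k.
  rewrite big_ltn; last by lia.
  by congr (_ * _); apply: eq_big_nat => k /andP[ik kj]; apply/eq_layer_prod/UU'.
have -> : \prod_(1 <= s < (b be.-1).+1) w U' be.-1 s = \prod_(1 <= s < (b be.-1).+1) w U be.-1 s.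
  by apply: eq_bigr => s _; apply/eq_w/UU'; lia.
have -> : \prod_(i <= k < be) (v ^+ k * w U' k (rk (r :: t) i k)) ^ (- alphav k mu) =
    pole i r ^ (- alphav i mu) *
    \prod_(i.+1 <= k < be) (v ^+ k * w U k (rk t i.+1 k)) ^ (- alphav k mu).
  rewrite big_ltn // rk_head /= wU' qE; congr (_ * _).
  by apply: eq_big_nat => k /andP[ik kj]; rewrite rkc // (eq_w (UU' k ik)).
have -> : \prod_(i <= k < be.-1) Wx U' k (rk (r :: t) i k) (v^-1 * w U' k.+1 (rk (r :: t) i k.+1)) =
    Wx X i r (v^-1 * w U i.+1 r1) *
    \prod_(i.+1 <= k < be.-1) Wx U k (rk t i.+1 k) (v^-1 * w U k.+1 (rk t i.+1 k.+1)).
  rewrite big_ltn; last by lia.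
  rewrite rk_head rkc // rk_head /= WU' (eq_w (UU' _ (ltnSn i))); congr (_ * _).
  apply: eq_big_nat => k /andP[ik kj]; rewrite !rkc ?(leqW ik) //.
  by rewrite (eq_w (UU' _ (leqW ik))) (eq_Wx _ _ (UU' k ik)).
have -> : \prod_(i <= k < be) Wx U' k (rk (r :: t) i k) (w U' k (rk (r :: t) i k)) =
    Wx X i r (v ^+ 2 * w X i r) * \prod_(i.+1 <= k < be) Wx U k (rk t i.+1 k) (w U k (rk t i.+1 k)).
  rewrite big_ltn // rk_head /= WU' wU'; congr (_ * _).
  by apply: eq_big_nat => k /andP[ik kj]; rewrite rkc // (eq_w (UU' k ik)) (eq_Wx _ _ (UU' k ik)).
have -> : \prod_(i <= k < be) Z k (w U' k (rk (r :: t) i k)) =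
    Z i (v ^+ 2 * w X i r) * \prod_(i.+1 <= k < be) Z k (w U k (rk t i.+1 k)).
  rewrite big_ltn // rk_head /= wU'; congr (_ * _).
  by apply: eq_big_nat => k /andP[ik kj]; rewrite rkc // (eq_w (UU' k ik)).
rewrite !rk_head /= rkc; last by lia.
rewrite wU' (eq_layer_prodV U'X) (eq_W _ U'X) vw.
have -> : w U' be.-1 (rk t i.+1 be.-1) = w U be.-1 (rk t i.+1 be.-1).
  by apply/eq_w/UU'; lia.
have -> : W U i (v^-1 * w U i.+1 (head 0%N t)) =
    (1 - w X i r / (v^-1 * w U i.+1 r1)) * Wx X i r (v^-1 * w U i.+1 r1).
  by rewrite (eq_W _ UX) (WD1 _ _ vr).
rewrite (layer_prodVE U) (eq_layer_prod UX) -/r1.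
have p0 := layer_prod_neq0 i.
have -> : (i%:Z - be%:Z) = (i.+1%:Z - be%:Z) - 1 by lia.
rewrite [_ - 1 + 1]addrAC [(-1) ^ _]expfzDr ?oppr_eq0 ?oner_eq0 //.
rewrite !exprN1; have vi0 : v ^+ i != 0 by rewrite expf_neq0.
rewrite [in LHS]invfM.
move: (pole i r ^ _) (w U be.-1 (rk t i.+1 be.-1))^-1 => Q D2.
move: (\prod_(i.+1 <= k < be) Wx U k (rk t i.+1 k) (w U k (rk t i.+1 k)))^-1 => D1.
move: (Wx X i r (v^-1 * _)) => N1.
rewrite /pole [v ^+ i.+2]exprS [v ^+ i.+1]exprS.
field.
by rewrite wr0 vi0 v0 ne Wr0 wr1 p0 oppr_eq0 oner_eq0.
Qed.

(** What remains of the product over the points [x] in [g_i] after multiplication by [Z_0^{-1}]. *)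
Definition points_prod i y := \prod_(s < N | (0 < ii s < i)%N) (1 - x s / y).

Definition coef i tf te :=
  fcoef_free X al i tf * (layer_prodV (shiftD i tf X) i * layer_prod (shiftD i tf X) i.-1) *
  ecoef_free (shiftD i tf X) i be te.

(** The part of a term that depends on [z], apart from [1/W_{i-1}]; [M i] is the total exponent of
    [z]. *)
Definition level i tf te y :=
  y ^ M i * points_prod i y * W (shiftD i tf X) i (v ^- i * y) * phi i tf y * eps (shiftD i tf X) i te y.

(** The numerator of a term over the linear factors given by [poles]. The factors [- pole] and ['X]
    come from [1/(1 - z/p) = -p/(z - p)] and [1/(1 - c/z) = z/(z - c)]; the last product keeps the
    zeros of [W_i] that cancel no pole of [f] or [e]. *)
Definition numer i tf te : {poly F} :=
  (coef i tf te)%:P * 'X^(delta i) * \prod_(s < N | (0 < ii s < i)%N) ('X - (x s)%:P)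
  * (if (i < al)%N then (- pole i (head 0%N tf))%:P else 1) * (if (i < be)%N then 'X else 1)
  * \prod_(1 <= s < (b i).+1 |
      ~~ ((i < al)%N && (s == head 0%N tf)) && ~~ ((i < be)%N && (s == head 0%N te)))
      ('X - (v ^+ i * w X i s)%:P).

(* The conjugated [g_i] has only a simple zero at [pole i r], where [f] and the conjugated
   [e] both have a pole in this case. *)
Definition double_pole i tf te := [&& (i < al)%N, (i < be)%N & head 0%N tf == head 0%N te].

Definition poles i tf te : seq (nat * nat) :=
  [seq (i.-1, s) | s <- iota 1 (b i.-1)] ++
  (if double_pole i tf te then [:: (i, head 0%N tf)] else [::]).

Lemma prod_sub (P : pred nat) U j (c y : F) : c != 0 -> y != 0 ->
  \prod_(1 <= s < (b j).+1 | P s) (y - c * w U j s) =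
  (\prod_(1 <= s < (b j).+1 | P s) y) * \prod_(1 <= s < (b j).+1 | P s) (1 - w U j s / (c^-1 * y)).
Proof.
move=> c0 y0; rewrite -big_split; apply: eq_bigr => s _ /=.
by rewrite invfM invrK; field.
Qed.

Lemma prod_iota_const j (y : F) : \prod_(1 <= s < (b j).+1) y = y ^+ b j.
Proof. by rewrite prodr_const_nat subn1. Qed.

Lemma prod_subT U j (c y : F) : c != 0 -> y != 0 ->
  \prod_(1 <= s < (b j).+1) (y - c * w U j s) = y ^+ b j * W U j (c^-1 * y).
Proof. by move=> c0 y0; rewrite prod_sub // prod_iota_const. Qed.

Lemma prod_D1 j r (G : nat -> F) : (0 < r <= b j)%N ->
  \prod_(1 <= s < (b j).+1) G s = G r * \prod_(1 <= s < (b j).+1 | s != r) G s.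
Proof.
by move=> vr; rewrite (bigD1_seq r) ?iota_uniq // mem_index_iota ltnS.
Qed.

(** The pole of [f] cancels the shifted zero of [W_i] at the head of [tf]. The pole of [e] cancels
    the zero at the head of [te], unless the heads agree and that zero has been used already. *)
Lemma numer_level i tf te y (U := shiftD i tf X) :
    valid_tuple i al tf -> valid_tuple i be te -> (i <= al)%N -> (i <= be)%N ->
    ((i < al)%N -> y != pole i (head 0%N tf)) ->
    ((i < be)%N -> y != v ^+ i * w U i (head 0%N te)) -> y != 0 ->
  \prod_(1 <= s < (b i).+1 |
      ~~ ((i < al)%N && (s == head 0%N tf)) && ~~ ((i < be)%N && (s == head 0%N te)))
      (y - v ^+ i * w X i s)
    * (if (i < al)%N then - pole i (head 0%N tf) else 1) * (if (i < be)%N then y else 1) =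
  y ^+ b i * W U i (v ^- i * y) * phi i tf y * eps U i te y
    * (if double_pole i tf te then y - pole i (head 0%N tf) else 1).
Proof.
move=> vtf vte ial ibe hf he y0.
have vi0 : v ^+ i != 0 by rewrite expf_neq0.
rewrite -prod_subT //.
have Utf : (i < al)%N -> forall s, w U i s = if s == head 0%N tf then v ^+ 2 * w X i s else w X i s.
  move=> lt s; rewrite /w /U shiftD_head; last by case: vtf => ->; lia.
  by case: ifP => _; rewrite ?exprMn.
have Unf : (i < al)%N = false -> forall s, w U i s = w X i s.
  move=> nlt s; rewrite /w /U /shiftD; case: vtf => -> _.
  by rewrite (_ : i + (al - i) = i)%N ?ltnn ?andbF //; lia.
have qE s : v ^+ i * (v ^+ 2 * w X i s) = pole i s by rewrite mulrA -exprD addn2.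
rewrite /phi /eps /double_pole.
case lf : (i < al)%N; case le : (i < be)%N => /=.
- have vr := valid_tuple_head vtf lf; have vr' := valid_tuple_head vte le.
  have q0 : pole i (head 0%N tf) != 0 by apply: pole_neq0.
  have hf' : y - pole i (head 0%N tf) != 0 by rewrite subr_eq0 hf.
  have he' : y - v ^+ i * w U i (head 0%N te) != 0 by rewrite subr_eq0 he.
  rewrite (prod_D1 _ vr) (Utf lf) eqxx qE.
  (* With equal heads the conjugated [e] has its pole at [pole i (head 0%N tf)] too, which leaves
     one linear factor uncancelled; with distinct heads its pole meets an unshifted zero. *)
  have [e|ne] := eqVneq (head 0%N tf) (head 0%N te).
    have -> : \prod_(1 <= s < (b i).+1 | s != head 0%N tf) (y - v ^+ i * w U i s) =
        \prod_(1 <= s < (b i).+1 | (s != head 0%N tf) && (s != head 0%N te)) (y - v ^+ i * w X i s).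
      apply: eq_big => [s|s sr]; first by rewrite -e andbb.
      by rewrite Utf // (negPf sr).
    by rewrite -e (Utf lf) eqxx qE; field; rewrite y0 q0 hf' /= -opprB oppr_eq0.
  rewrite (Utf lf) [head 0%N te == _]eq_sym (negPf ne) in he' *.
  have -> : \prod_(1 <= s < (b i).+1 | s != head 0%N tf) (y - v ^+ i * w U i s) =
      (y - v ^+ i * w X i (head 0%N te)) *
      \prod_(1 <= s < (b i).+1 | (s != head 0%N tf) && (s != head 0%N te)) (y - v ^+ i * w X i s).
    rewrite (eq_bigr (fun s => y - v ^+ i * w X i s)) => [|s sr]; last by rewrite Utf // (negPf sr).
    rewrite -big_filter (bigD1_seq (head 0%N te)) ?filter_uniq ?iota_uniq //=; last first.
      by rewrite mem_filter mem_index_iota ltnS vr' eq_sym ne.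
    by rewrite big_filter_cond.
  by field; rewrite y0 q0 he' /= -opprB oppr_eq0.
- have vr := valid_tuple_head vtf lf.
  have q0 : pole i (head 0%N tf) != 0 by apply: pole_neq0.
  have hf' : y - pole i (head 0%N tf) != 0 by rewrite subr_eq0 hf.
  rewrite (prod_D1 _ vr) (Utf lf) eqxx qE.
  have -> : \prod_(1 <= s < (b i).+1 | s != head 0%N tf) (y - v ^+ i * w U i s) =
      \prod_(1 <= s < (b i).+1 | (s != head 0%N tf) && true) (y - v ^+ i * w X i s).
    apply: eq_big => [s|s sr]; first by rewrite andbT.
    by rewrite Utf // (negPf sr).
  by field; rewrite q0 /= -opprB oppr_eq0.
- have vr' := valid_tuple_head vte le.
  have he' : y - v ^+ i * w U i (head 0%N te) != 0 by rewrite subr_eq0 he.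
  rewrite (prod_D1 _ vr') (Unf lf) in he' *.
  have -> : \prod_(1 <= s < (b i).+1 | s != head 0%N te) (y - v ^+ i * w U i s) =
      \prod_(1 <= s < (b i).+1 | s != head 0%N te) (y - v ^+ i * w X i s).
    by apply: eq_bigr => s sr; rewrite Unf.
  by field; rewrite y0 he'.
- by rewrite !mulr1; apply: eq_bigr => s _; rewrite Unf.
Qed.

(** * Values and residues of the terms *)

Hypothesis M_step : forall i, M i - M i.+1 = alphav i mu.
Hypothesis M_degree : forall i, (0 < i <= al)%N ->
  M i + (b i.-1)%:Z - (b i)%:Z = (delta i)%:Z + #|[pred s | (0 < ii s < i)%N]|%:Z.

(** Passing from factors [1 - c/y] to monic factors [y - c] costs the powers of [y] that [M_degree]
    balances. *)
Lemma monomial_factor i y : (0 < i <= al)%N -> y != 0 ->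
  y ^+ delta i * \prod_(s < N | (0 < ii s < i)%N) (y - x s) =
  y ^ M i * y ^+ b i.-1 / y ^+ b i * points_prod i y.
Proof.
move=> hi y0.
have -> : \prod_(s < N | (0 < ii s < i)%N) (y - x s) =
    y ^+ #|[pred s | (0 < ii s < i)%N]| * points_prod i y.
  rewrite -prodr_const -big_split; apply: eq_bigr => s _ /=.
  by rewrite mulrBr mulr1 mulrCA divff // mulr1.
rewrite mulrA; congr (_ * _); rewrite !exprnP -[_ / _]/(_ * _) invr_expz -!expfzDr //.
by rewrite -M_degree.
Qed.

Lemma horner_numer i tf te y : (numer i tf te).[y] =
  coef i tf te * (y ^+ delta i * \prod_(s < N | (0 < ii s < i)%N) (y - x s)) *
  (\prod_(1 <= s < (b i).+1 |
      ~~ ((i < al)%N && (s == head 0%N tf)) && ~~ ((i < be)%N && (s == head 0%N te)))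
      (y - v ^+ i * w X i s)
    * (if (i < al)%N then - pole i (head 0%N tf) else 1) * (if (i < be)%N then y else 1)).
Proof.
rewrite /numer !hornerM hornerC hornerXn !horner_prod.
under eq_bigr do rewrite hornerXsubC.
under [X in _ * X = _]eq_bigr do rewrite hornerXsubC.
have h1 : (1 : {poly F}).[y] = 1 by exact: hornerC.
rewrite !(fun_if (fun p => horner p y)) !(h1, hornerC, hornerX).
by case: ifP => _; case: ifP => _; ring.
Qed.

Lemma numer_eval i tf te y (U := shiftD i tf X) :
    valid_tuple i al tf -> valid_tuple i be te -> (0 < i)%N -> (i <= al)%N -> (i <= be)%N ->
    ((i < al)%N -> y != pole i (head 0%N tf)) ->
    ((i < be)%N -> y != v ^+ i * w U i (head 0%N te)) -> y != 0 ->
  (numer i tf te).[y] = coef i tf te * level i tf te y * y ^+ b i.-1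
    * (if double_pole i tf te then y - pole i (head 0%N tf) else 1).
Proof.
move=> vtf vte i0 ial ibe hf he y0.
rewrite horner_numer numer_level // monomial_factor ?i0 // /level.
have yb : y ^+ b i != 0 by rewrite expf_neq0.
by move: (if _ then _ else _) => dp; field.
Qed.

Lemma prod_pole i y : y != 0 ->
  \prod_(1 <= s < (b i).+1) (y - pole i s) = y ^+ b i * W X i (v ^- i.+2 * y).
Proof. by move=> y0; rewrite prod_subT // expf_neq0. Qed.

Lemma prod_poles i tf te y (P : pred (nat * nat)) : \prod_(k <- poles i tf te | P k) (y - pole k.1 k.2) =
  \prod_(1 <= s < (b i.-1).+1 | P (i.-1, s)) (y - pole i.-1 s) *
  (if double_pole i tf te && P (i, head 0%N tf) then y - pole i (head 0%N tf) else 1).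
Proof.
rewrite /poles big_cat big_map /index_iota subn1 /=; congr (_ * _).
case: double_pole; last by rewrite big_nil.
by rewrite big_mkcond big_seq1.
Qed.

(** The conditions on [y] keep it away from the poles of [f] and of the conjugated [e], where [phi]
    or [eps] would invert 0. *)
Lemma numer_poles_eval i tf te y (U := shiftD i tf X) :
    valid_tuple i al tf -> valid_tuple i be te -> (0 < i)%N -> (i <= al)%N -> (i <= be)%N ->
    ((i < al)%N -> y != pole i (head 0%N tf)) ->
    ((i < be)%N -> y != v ^+ i * w U i (head 0%N te)) -> y != 0 ->
  (numer i tf te).[y] / \prod_(k <- poles i tf te) (y - pole k.1 k.2) =
  coef i tf te * (level i tf te y / W X i.-1 (v ^- i.+1 * y)).
Proof.
move=> vtf vte i0 ial ibe hf he y0; rewrite numer_eval // prod_poles andbT prod_pole //.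
rewrite (_ : i.-1.+2 = i.+1); last by lia.
have yb : y ^+ b i.-1 != 0 by rewrite expf_neq0.
have dp0 : (if double_pole i tf te then y - pole i (head 0%N tf) else 1) != 0.
  by case: ifP => [/and3P[/hf]|_]; rewrite ?subr_eq0 ?oner_eq0.
rewrite !invfM; move: (W _ _ _)^-1 (if _ then _ else _) dp0 => Wi dp dp0.
by field; rewrite yb dp0.
Qed.

Lemma pole_inj i j r s : (0 < r <= b i)%N -> (0 < s <= b j)%N -> pole i r = pole j s -> (i, r) = (j, s).
Proof. by move=> vr vs; apply: (X_indep (k := i.+2) (l := j.+2)). Qed.

(** At level [i.+1] the pole comes from [1/W_i] alone. As it lies in layer [i], it avoids the poles
    of [f] and [e] in layer [i.+1], so [numer_eval] applies. *)
Lemma upper_residue i r tf te (y := pole i r) :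
    (i < al)%N -> (i < be)%N -> (0 < i)%N -> (0 < r <= b i)%N ->
    valid_tuple i.+1 al tf -> valid_tuple i.+1 be te ->
  (numer i.+1 tf te).[y] / \prod_(k <- poles i.+1 tf te | k != (i, r)) (y - pole k.1 k.2) =
  coef i.+1 tf te * (level i.+1 tf te y * y / Wx X i r (w X i r)).
Proof.
move=> ial ibe i0 vr vtf vte; have y0 : y != 0 by apply: pole_neq0.
have hf : (i.+1 < al)%N -> y != pole i.+1 (head 0%N tf).
  move=> h; have vs := valid_tuple_head vtf h.
  by apply/eqP => /(pole_inj vr vs)[]; lia.
have he : (i.+1 < be)%N -> y != v ^+ i.+1 * w (shiftD i.+1 tf X) i.+1 (head 0%N te).
  move=> h; have vs := valid_tuple_head vte h.
  have [l ->] := shiftD_exp i.+1 tf i.+1 (head 0%N te).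
  rewrite mulrA -[v ^+ i.+1]/(v ^ i.+1%:Z) -expfzDr //.
  by apply: (w_indep i.+2) => //; rewrite xpair_eqE negb_and; apply/orP; left; lia.
rewrite numer_eval // prod_poles /=.
have -> : (i.+1, head 0%N tf) != (i, r) by rewrite xpair_eqE negb_and; apply/orP; left; lia.
have -> : \prod_(1 <= s < (b i).+1 | (i, s) != (i, r)) (y - pole i s) =
    (\prod_(1 <= s < (b i).+1 | s != r) y) * Wx X i r (w X i r).
  rewrite (eq_bigl (fun s => s != r)) => [|s]; last by rewrite xpair_eqE eqxx.
  by rewrite prod_sub ?expf_neq0 // mulKf ?expf_neq0.
rewrite andbT -prod_iota_const (prod_D1 _ vr); set E := \prod_(_ <= _ < _ | _) _.
have E0 : E != 0 by rewrite prodf_seq_neq0; apply/allP => s _; rewrite y0 implybT.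
have dp0 : (if double_pole i.+1 tf te then y - pole i.+1 (head 0%N tf) else 1) != 0.
  by case: ifP => [/and3P[/hf]|_]; rewrite ?subr_eq0 ?oner_eq0.
rewrite !invfM; move: (Wx _ _ _ _)^-1 (if _ then _ else _) dp0 => Wi dp dp0.
by field; rewrite dp0 E0.
Qed.

(** Here the point is a pole of [f] and [e], where [level] is meaningless, so the polynomial [numer]
    is evaluated directly. The minus sign comes from its factor [- pole]. *)
Lemma lower_residue i r tf te (y := pole i r) :
    (i < al)%N -> (i < be)%N -> (0 < i)%N -> (0 < r <= b i)%N ->
  (numer i (r :: tf) (r :: te)).[y] /
    \prod_(k <- poles i (r :: tf) (r :: te) | k != (i, r)) (y - pole k.1 k.2) =
  - coef i (r :: tf) (r :: te) *
  (y ^ M i * points_prod i y * y * Wx X i r (v ^+ 2 * w X i r) / W X i.-1 (v * w X i r)).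
Proof.
move=> ial ibe i0 vr; have y0 : y != 0 by apply: pole_neq0.
rewrite horner_numer monomial_factor ?i0 ?(ltnW ial) // prod_poles ial ibe /= eqxx andbF mulr1.
have -> : \prod_(1 <= s < (b i.-1).+1 | (i.-1, s) != (i, r)) (y - pole i.-1 s) =
    y ^+ b i.-1 * W X i.-1 (v * w X i r).
  rewrite (eq_bigl predT) => [|s]; last by rewrite xpair_eqE negb_and; apply/orP; left; lia.
  rewrite prod_pole // (_ : i.-1.+2 = i.+1); last by lia.
  by rewrite /y /pole [v ^+ i.+2]exprSr -!mulrA mulKf ?expf_neq0.
have -> : \prod_(1 <= s < (b i).+1 | ~~ (s == r) && ~~ (s == r)) (y - v ^+ i * w X i s) =
    (\prod_(1 <= s < (b i).+1 | s != r) y) * Wx X i r (v ^+ 2 * w X i r).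
  rewrite (eq_bigl (fun s => s != r)) => [|s]; last by rewrite andbb.
  rewrite prod_sub ?expf_neq0 //; congr (_ * Wx _ _ _ _).
  by rewrite /y /pole -addn2 exprD -!mulrA mulKf ?expf_neq0.
rewrite -/y -[y ^+ b i]prod_iota_const (prod_D1 _ vr); set E := \prod_(_ <= _ < _ | _) _.
have E0 : E != 0 by rewrite prodf_seq_neq0; apply/allP => s _; rewrite y0 implybT.
have yb : y ^+ b i.-1 != 0 by rewrite expf_neq0.
have W0 : W X i.-1 (v * w X i r) != 0 by apply: (W_neq0 1) => //; lia.
by clearbody y; field; rewrite W0 yb E0 y0.
Qed.

(** The two recursions express the coefficient at level [i] through the one at level [i.+1]; the
    sign left over is that of [lower_residue]. *)
Lemma residues_cancel i r tf te (y := pole i r) :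
    (i < al)%N -> (i < be)%N -> (0 < i)%N ->
    valid_tuple i al (r :: tf) -> valid_tuple i be (r :: te) ->
  (numer i (r :: tf) (r :: te)).[y] /
    \prod_(k <- poles i (r :: tf) (r :: te) | k != (i, r)) (y - pole k.1 k.2) +
  (numer i.+1 tf te).[y] / \prod_(k <- poles i.+1 tf te | k != (i, r)) (y - pole k.1 k.2) = 0.
Proof.
move=> ial ibe i0 vtf vte; have vr := valid_tuple_head vtf ial; rewrite /= in vr.
have vtf' := valid_tuple_behead ial vtf; have vte' := valid_tuple_behead ibe vte.
rewrite lower_residue // upper_residue //.
rewrite /coef fcoef_free_step // ecoef_free_step //.
have y0 : y != 0 by apply: pole_neq0.
have p0 := layer_prod_neq0.
set U := shiftD i.+1 tf X; set U' := shiftD i (r :: tf) X.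
have Ui : U i =1 X i by apply: shiftD_below.
have U'i : U' i.-1 =1 X i.-1 by apply: shiftD_below; lia.
have pU' : layer_prod U' i = v * layer_prod X i by apply: layer_prod_shiftD.
(* The factor [Z_i] of [e] supplies exactly the points with [i_s = i], since [y] is [v^i] times its
   argument. *)
have PLS : points_prod i.+1 y = points_prod i y * Z i (v ^+ 2 * w X i r).
  rewrite /points_prod (bigID (fun s => ii s == i)) /= mulrC; congr (_ * _).
    by apply: eq_bigl => s; lia.
  apply: eq_big => [s|s /andP[_ /eqP si]]; first by lia.
  congr (1 - _); rewrite /y /pole -addn2 exprD -!mulrA invfM mulrCA mulrA.
  by rewrite [v ^- i * _]mulrC.
(* The factor [pole i r ^ (- alphav i mu)] of [e] compensates the change of the exponent of [z]
   between the two levels. *)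
have MS : y ^ M i = y ^ M i.+1 * y ^ alphav i mu by rewrite -M_step -expfzDr // addrC subrK.
have yV : y ^ (- alphav i mu) = (y ^ alphav i mu)^-1 by rewrite invr_expz.
have ya : y ^ alphav i mu != 0 by rewrite expfz_neq0.
have yv : v ^- i.+1 * y = v * w X i r.
  by rewrite /y /pole [v ^+ i.+2]exprSr -!mulrA mulKf ?expf_neq0.
have Wi0 : W X i.-1 (v * w X i r) != 0 by apply: (W_neq0 1) => //; lia.
have Wxi0 : Wx X i r (v ^+ 2 * w X i r) != 0 by apply: (Wx_neq0 2).
rewrite !layer_prodVE (eq_layer_prod U'i) /= (eq_layer_prod Ui) -/y MS yV /level yv PLS pU'.
move: (phi _ _ _) (eps _ _ _ _) (W U _ _) (Z _ _) (points_prod _ _) => f e W1 Z1 P1.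
move: (layer_prod U i.+1)^-1 (Wx X i r (w X i r))^-1 => pV WV.
have p1 := p0 i; have p2 := p0 i.-1.
by field; rewrite Wi0 Wxi0 ya p2 p1 v0.
Qed.

(** * Tuples and the poles they carry *)

Definition layer_tuples (i j : nat) := tuples [seq b k | k <- iota i (j - i)].

Lemma layer_tuples_nil i : layer_tuples i i = [:: [::]].
Proof. by rewrite /layer_tuples subnn. Qed.

Lemma layer_tuples_step i j : (i < j)%N ->
  layer_tuples i j = [seq r :: t | r <- iota 1 (b i), t <- layer_tuples i.+1 j].
Proof. by move=> ij; rewrite /layer_tuples (_ : j - i = (j - i.+1).+1)%N //; lia. Qed.

Lemma valid_tuple_cons i j r t : (i < j)%N -> (0 < r <= b i)%N -> valid_tuple i.+1 j t ->
  valid_tuple i j (r :: t).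
Proof.
move=> ij vr [st h]; split; first by rewrite /= st; lia.
move=> k /andP[]; rewrite leq_eqVlt => /orP[/eqP<- _|ik kj]; first by rewrite rk_head.
by rewrite rk_cons // h // ik.
Qed.

Lemma mem_layer_tuples i j t : (i <= j)%N -> t \in layer_tuples i j -> valid_tuple i j t.
Proof.
move: {2}(j - i)%N (erefl (j - i)%N) => d; elim: d i t => [|d IH] i t ji ij.
  have -> : j = i by lia.
  rewrite layer_tuples_nil inE => /eqP->; split=> [|k]; first by rewrite subnn.
  by case: ltngtP.
rewrite layer_tuples_step; last by lia.
case/allpairsP=> -[r t'] /= [ri ti ->]; apply: valid_tuple_cons; first by lia.
  by move: ri; rewrite mem_iota add1n.
by apply: IH ti; lia.
Qed.

Lemma mem_poles i tf te k r : ((k, r) \in poles i tf te) =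
  (k == i.-1) && (0 < r <= b k)%N || [&& double_pole i tf te, k == i & r == head 0%N tf].
Proof.
rewrite mem_cat; congr (_ || _).
  apply/mapP/andP => [[s] | [/eqP-> vr]]; last by exists r; rewrite ?mem_iota ?add1n.
  by rewrite mem_iota add1n => vs [-> ->]; rewrite eqxx.
by case: double_pole; rewrite ?inE // xpair_eqE.
Qed.

(** Positivity of [i] keeps the layers [i.-1] and [i] distinct, as [0.-1 = 0]. *)
Lemma poles_uniq i tf te : (0 < i)%N -> uniq (poles i tf te).
Proof.
move=> i0; rewrite cat_uniq map_inj_uniq ?iota_uniq //=; last by move=> s t [].
case: double_pole => //=; rewrite !andbT orbF; apply/mapP => -[s _ []]; lia.
Qed.

(** * Sum of all terms with a given monomial in the [D]'s, selected by [E] *)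

Section Total.

Variables (S : F -> Prop) (z : F) (E : nat -> seq nat -> seq nat -> bool).
Hypothesis S0 : S 0.
Hypothesis S1 : S 1.
Hypothesis SN : forall x, S x -> S (- x).
Hypothesis SD : forall x y, S x -> S y -> S (x + y).
Hypothesis SM : forall x y, S x -> S y -> S (x * y).
Hypothesis S_x : forall s, S (x s).
Hypothesis S_v : forall k : int, S (v ^ k).
Hypothesis S_X : forall i r, S (X i r) /\ S (X i r)^-1.
Hypothesis S_inv : forall i r s (k : int), (0 < r <= b i)%N -> (0 < s <= b i)%N -> s != r ->
  S (1 - v ^ k * (w X i s / w X i r))^-1.
Hypothesis b0 : b 0 = 0%N.
Hypothesis z0 : z != 0.
Hypothesis z_indep : forall i r (k : int), (0 < r <= b i)%N -> z != v ^ k * w X i r.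
Hypothesis E_cons : forall i r tf te, E i (r :: tf) (r :: te) = E i.+1 tf te.

Definition S_unit y := S y /\ S y^-1.

Lemma S_unit_M x1 x2 : S_unit x1 -> S_unit x2 -> S_unit (x1 * x2).
Proof. by move=> [? ?] [? ?]; split; rewrite ?invfM; apply: SM. Qed.

Lemma S_unitV y : S_unit y -> S_unit y^-1.
Proof. by move=> [? ?]; split; rewrite ?invrK. Qed.

Lemma S_unit_expz y (k : int) : S_unit y -> S_unit (y ^ k).
Proof.
have H y' m : S_unit y' -> S_unit (y' ^+ m).
  move=> Sy; elim: m => [|m IH]; first by split; rewrite ?invr1.
  by rewrite exprS; apply: S_unit_M.
by case: k => k Sy; rewrite ?NegzE -?exprnN -?exprnP; [|apply: S_unitV]; apply: H.
Qed.

Lemma S_unit_v (k : int) : S_unit (v ^ k).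
Proof. by split; rewrite ?invr_expz; apply: S_v. Qed.

Lemma S_unit_vn k : S_unit (v ^+ k).
Proof. exact: (S_unit_v k). Qed.

Lemma S_prod (I : eqType) (r : seq I) (P : pred I) (G : I -> F) :
  (forall i, i \in r -> P i -> S (G i)) -> S (\prod_(i <- r | P i) G i).
Proof.
move=> SG; rewrite big_seq_cond; elim/big_rec: _ => // i y /andP[ri Pi] Sy.
by apply: SM => //; apply: SG.
Qed.

Lemma S_unit_shiftD i t k r : S_unit (shiftD i t X k r).
Proof.
by rewrite /shiftD; case: ifP => _ //; apply: S_unit_M; first exact: (S_unit_v 1).
Qed.

Lemma S_unit_w i t k r : S_unit (w (shiftD i t X) k r).
Proof. by rewrite /w expr2; apply: S_unit_M; apply: S_unit_shiftD. Qed.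

Lemma S_vw k i r : S (v ^+ k * w X i r).
Proof. by apply: SM; [apply: (S_v k)|rewrite /w expr2; apply: SM; case: (S_X i r)]. Qed.

Lemma S_W i t j y : S_unit y -> S (W (shiftD i t X) j y).
Proof.
move=> [_ Sy]; apply: S_prod => s _ _; apply: SD => //; apply/SN/SM => //.
by case: (S_unit_w i t j s).
Qed.

Lemma S_Wx i t j r y : S_unit y -> S (Wx (shiftD i t X) j r y).
Proof.
move=> [_ Sy]; apply: S_prod => s _ _; apply: SD => //; apply/SN/SM => //.
by case: (S_unit_w i t j s).
Qed.

(** Within a layer the ratio of two shifted variables is the unshifted ratio times a power of [v],
    so each factor is inverted by [S_inv]. *)
Lemma S_WxV i t j r (U := shiftD i t X) : (0 < r <= b j)%N -> S (Wx U j r (w U j r))^-1.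
Proof.
move=> vr; rewrite /Wx -prodfV; apply: S_prod => s; rewrite mem_index_iota ltnS => vs sr.
have [l ->] := shiftD_exp i t j s; have [k ->] := shiftD_exp i t j r.
have -> : v ^ l * w X j s / (v ^ k * w X j r) = v ^ (l - k) * (w X j s / w X j r).
  by rewrite expfzDr // -invr_expz invfM mulrACA.
exact: S_inv.
Qed.

Lemma S_layer_prod i t j : S (layer_prod (shiftD i t X) j).
Proof. by apply: S_prod => s _ _; case: (S_unit_shiftD i t j s). Qed.

Lemma S_layer_prodV i t j : S (layer_prodV (shiftD i t X) j).
Proof. by apply: S_prod => s _ _; case: (S_unit_shiftD i t j s). Qed.

Lemma S_sign (k : int) : S ((-1) ^ k).
Proof.
by case: (@S_unit_expz (-1) k) => //; split; rewrite ?invrN ?invr1; apply: SN.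
Qed.

Lemma S_Z i t j k r : S (Z j (w (shiftD i t X) k r)).
Proof.
apply: S_prod => s _ _; apply: SD => //; apply/SN/SM; last by case: (S_unit_w i t k r).
by apply: SM => //; case: (S_unit_vn j).
Qed.

Lemma S_fcoef_free i t tf : (i <= al)%N -> valid_tuple i al tf -> S (fcoef_free (shiftD i t X) al i tf).
Proof.
move=> ial [_ vt]; rewrite /fcoef_free; case: eqP => // ne.
have w_ k r := S_unit_w i t k r.
have vw k r : S_unit (v * w (shiftD i t X) k r) by apply: S_unit_M (S_unit_v 1) _.
apply: SM; [apply: SM; [apply: SM|]|apply: SM; [apply: SM; [apply: SM|]|]].
- exact: S_sign.
- exact: S_v.
- by apply: S_prod => k _ _; apply: S_layer_prodV.
- exact: S_W.
- by apply: S_prod => k _ _; apply: S_Wx.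
- rewrite -prodfV; apply: S_prod => k; rewrite mem_index_iota => hk _.
  by apply/S_WxV/vt.
- by apply: SM; [case: (w_ al.-1 (rk tf i al.-1))|case: (w_ i (rk tf i i))].
Qed.

Lemma S_ecoef_free i t te : (i <= be)%N -> valid_tuple i be te -> S (ecoef_free (shiftD i t X) i be te).
Proof.
move=> ibe [_ vt]; rewrite /ecoef_free; case: eqP => // ne.
have w_ k r := S_unit_w i t k r.
have vw k r : S_unit (v^-1 * w (shiftD i t X) k r).
  by apply: S_unit_M => //; apply/S_unitV/(S_unit_v 1).
apply: SM; [apply: SM; [apply: SM; [apply: SM|]|]|apply: SM; [apply: SM; [apply: SM;
  [|apply: SM; [apply: SM|]]|]|]].
- exact: S_sign.
- by apply: S_prod => k _ _; case: (w_ be.-1 k).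
- by apply: S_prod => k _ _; apply: S_layer_prod.
- exact: S_layer_prodV.
- apply: S_prod => k _ _.
  by case: (@S_unit_expz (v ^+ k * w (shiftD i t X) k (rk te i k)) (- alphav k mu)) => //;
    apply: S_unit_M => //; apply: S_unit_vn.
- exact: S_W.
- by apply: S_prod => k _ _; apply: S_Wx.
- rewrite -prodfV; apply: S_prod => k; rewrite mem_index_iota => hk _.
  by apply/S_WxV/vt.
- by apply: S_prod => k _ _; apply: S_Z.
- by apply: SM; [case: (w_ i (rk te i i))|case: (w_ be.-1 (rk te i be.-1))].
Qed.

Lemma shiftD_nil i : shiftD i [::] X = X.
Proof.
apply: functional_extensionality => k; apply: functional_extensionality => r.
by rewrite /shiftD addn0; case: ltngtP.
Qed.

Lemma S_coef i tf te : (0 < i)%N -> (i <= al)%N -> (i <= be)%N ->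
  valid_tuple i al tf -> valid_tuple i be te -> S (coef i tf te).
Proof.
move=> i0 ial ibe vtf vte; apply: SM; [apply: SM|exact: S_ecoef_free].
  by rewrite -{1}(shiftD_nil i); apply: S_fcoef_free.
by apply: SM; [apply: S_layer_prodV|apply: S_layer_prod].
Qed.

Lemma coefs_in_numer i tf te : S (coef i tf te) -> coefs_in S (numer i tf te).
Proof.
move=> Sc; rewrite /numer.
have CM := coefs_inM S0 SD SM; have CC := coefs_inC S0.
have CXC c : S c -> coefs_in S ('X - c%:P) by apply: coefs_inXsubC.
have CX : coefs_in S 'X by apply: coefs_inX.
have C1 : coefs_in S 1 by rewrite -[1]/(1%:P); apply: CC.
apply: (CM); [apply: (CM); [apply: (CM); [apply: (CM); [apply: (CM)|]|]|]|]; first exact: CC.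
- exact: coefs_in_exp.
- by apply: coefs_in_prod => // s _ _; apply: CXC.
- by case: ifP => _ //; apply/CC/SN/S_vw.
- by case: ifP.
- by apply: coefs_in_prod => // s _ _; apply/CXC/S_vw.
Qed.

Definition terms : seq (nat * seq nat * seq nat) :=
  [seq (it, te) | it <- [seq (i, tf) | i <- iota 1 (minn al be), tf <- layer_tuples i al],
                  te <- layer_tuples it.1 be].

Lemma sum_terms (G : nat * seq nat * seq nat -> F) : \sum_(t <- terms) G t =
  \sum_(i <- iota 1 (minn al be)) \sum_(tf <- layer_tuples i al) \sum_(te <- layer_tuples i be)
    G (i, tf, te).
Proof. by rewrite big_allpairs_dep big_allpairs_dep. Qed.

Lemma mem_terms i tf te : (i, tf, te) \in terms ->
  [/\ (0 < i)%N, (i <= al)%N, (i <= be)%N, valid_tuple i al tf & valid_tuple i be te].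
Proof.
case/allpairsPdep=> -[i1 tf1] [te1 [/allpairsPdep[i2 [tf2 [hi htf [? ?]]]] hte [? ? ?]]]; subst.
move: hi hte; rewrite mem_iota /= => hi hte.
by split; try lia; apply: mem_layer_tuples => //; lia.
Qed.

(** [sum_of_cancelling_poles] is applied to the terms selected by [E]; its residue condition reduces
    to [residues_cancel]. *)
Lemma total_regular : exists2 P, coefs_in S P &
  \sum_(i <- iota 1 (minn al be)) \sum_(tf <- layer_tuples i al) \sum_(te <- layer_tuples i be)
    (if E i tf te then coef i tf te * (level i tf te z / W X i.-1 (v ^- i.+1 * z)) else 0) =
  P.[z].
Proof.
pose m := minn al be.
(* A pole in layer [k] needs level [k.+1] or a double pole at level [k]; either way [k < m]. *)
pose Qs := [seq (k, s) | k <- iota 1 m.-1, s <- iota 1 (b k)].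
have memQs (k s : nat) : ((k, s) \in Qs) = (0 < k < m)%N && (0 < s <= b k)%N.
  apply/allpairsPdep/andP => [[k' [s' [hk hs [-> ->]]]] | [hk hs]].
    by move: hk hs; rewrite !mem_iota; lia.
  by exists k, s; rewrite !mem_iota; split=> //; lia.
pose T := [seq t <- terms | E t.1.1 t.1.2 t.2].
have TE (t : nat * seq nat * seq nat) : t \in T -> [/\ (0 < t.1.1)%N, (t.1.1 <= al)%N, (t.1.1 <= be)%N,
    valid_tuple t.1.1 al t.1.2 & valid_tuple t.1.1 be t.2].
  by case: t => -[i tf] te; rewrite mem_filter => /andP[_ /mem_terms].
have [|||||||P SP PE] := sum_of_cancelling_poles S0 S1 SN SD SM
    (q := fun k => pole k.1 k.2) (Qs := Qs) (z := z) (L := T)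
    (A := fun t => numer t.1.1 t.1.2 t.2) (D := fun t => poles t.1.1 t.1.2 t.2).
- rewrite allpairs_uniq_dep ?iota_uniq // => [k _|[k s] [k' s'] _ _ [-> ->]] //.
  exact: iota_uniq.
- move=> [k s] [k' s']; rewrite !memQs => /andP[_ vs] /andP[_ vs'] /=.
  exact: pole_inj.
- by move=> [k s] _; apply: S_vw.
- by move=> [k s]; rewrite memQs => /andP[_ vs]; apply: (z_indep k.+2).
- by move=> t /TE[h1 h2 h3 h4 h5]; apply/coefs_in_numer/S_coef.
- move=> [[i tf] te] /TE /= [h1 h2 h3 h4 h5]; split; first exact: poles_uniq.
  move=> [k s]; rewrite mem_poles memQs => /orP[/andP[/eqP-> vs]|].
    (* Level 1 has no poles from [1/W_0], layer 0 being empty. *)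
    have h0 : (i.-1 != 0)%N.
      by apply: contraTneq vs => ->; rewrite b0; case: s.
    by rewrite vs andbT /m; lia.
  case/and3P=> /and3P[l1 l2 l3] /eqP-> /eqP->; rewrite (valid_tuple_head h4 l1) andbT /m; lia.
- case=> i0 r0; rewrite memQs => /andP[hi0 vr0] /=.
  rewrite big_filter_cond big_mkcond sum_terms /=.
  set G := fun i tf te => (if E i tf te && ((i0, r0) \in poles i tf te) then
    (numer i tf te).[pole i0 r0] / \prod_(k <- poles i tf te | k != (i0, r0)) (pole i0 r0 - pole k.1 k.2)
    else 0).
  (* Only level [i0], through a double pole, and level [i0.+1], through [1/W_{i0}], can
     contribute. *)
  rewrite -/(m) (bigD1_seq i0) ?iota_uniq ?mem_iota //=; last by lia.
  rewrite -[X in _ + X]big_filter [X in _ + X](bigD1_seq i0.+1) ?filter_uniq ?iota_uniq ?mem_filter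
    ?mem_iota //=; last by lia.
  rewrite big_filter_cond [X in _ + (_ + X)]big1 ?addr0; last first.
    move=> i /andP[ne1 ne2]; apply: big1 => tf _; apply: big1 => te _.
    rewrite mem_poles; case: ifP => // /andP[_ /orP[/andP[]|/and3P[_]]]; lia.
  have [li1 li2] : (i0 < al)%N /\ (i0 < be)%N by rewrite /m in hi0; lia.
  rewrite (layer_tuples_step li1) (layer_tuples_step li2) big_allpairs_dep.
  (* At level [i0] both tuples must start with [r0] for the pole to occur. *)
  rewrite (bigD1_seq r0) ?iota_uniq ?mem_iota //=.
  rewrite [X in _ + X + _]big1 ?addr0; last first.
    move=> r ne; apply: big1 => tf _; apply: big1 => te _.
    rewrite mem_poles /=; case: ifP => // /andP[_ /orP[/andP[]|/and3P[_ _]]]; lia.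
  (* The tails at level [i0] run over the tuples of level [i0.+1], so the two sums can be merged and
     cancelled pair by pair. *)
  rewrite -big_split big_seq big1 //= => tf htf.
  rewrite big_allpairs_dep (bigD1_seq r0) ?iota_uniq ?mem_iota //=.
  rewrite [X in _ + X + _]big1 ?addr0; last first.
    move=> r ne; apply: big1 => te _.
    rewrite mem_poles /double_pole /=; case: ifP => // /andP[_ /orP[/andP[]|/and3P[/and3P[_ _]]]]; lia.
  rewrite -big_split big_seq big1 //= => te hte.
  have vtf : valid_tuple i0.+1 al tf by apply: mem_layer_tuples htf.
  have vte : valid_tuple i0.+1 be te by apply: mem_layer_tuples hte.
  rewrite !mem_poles /double_pole /= li1 li2 !eqxx vr0 /= orbT !andbT E_cons //.
  case: (E i0.+1 tf te); last by rewrite addr0.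
  by apply: residues_cancel => //; [lia|apply: valid_tuple_cons..].
exists P => //; rewrite -PE big_filter [RHS]big_mkcond sum_terms /=.
apply: eq_big_seq => i hi; apply: eq_big_seq => tf htf; apply: eq_big_seq => te hte.
move: hi; rewrite mem_iota => hi.
have vtf : valid_tuple i al tf by apply: mem_layer_tuples htf; lia.
have vte : valid_tuple i be te by apply: mem_layer_tuples hte; lia.
case: ifP => // _; rewrite numer_poles_eval //; try lia.
- by move=> h; apply: (z_indep i.+2); apply: valid_tuple_head h.
- move=> h; have vs := valid_tuple_head vte h.
  have [l ->] := shiftD_exp i tf i (head 0%N te).
  by rewrite mulrA -[v ^+ i]/(v ^ i%:Z) -expfzDr //; apply: z_indep.
Qed.

End Total.

End LaxTerms.

(** * The Lax matrix *)

(** The exponent at [y] is the sum of the [gamma_s] with [x_s = y] and [i_s < i]. The points with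
    [i_s = 0] form [Z_0], which cancels; the others have [gamma_s = 1], hence no negative exponent
    is left. *)
Lemma prod_points_Z0 (F : fieldType) (T : eqType) (f : T -> F) (N : nat) (ii : 'I_N -> nat)
    (xx : 'I_N -> T) (gam : 'I_N -> int) (z v : F) (i : nat) :
  (forall s, 1 - f (xx s) / z != 0) -> (forall s, ii s != 0%N -> gam s = 1) -> (0 < i)%N ->
  (\prod_(s < N | ii s == 0%N) (1 - v ^- 0 * f (xx s) / z) ^ gam s)^-1 *
  \prod_(y <- undup [seq xx s | s <- enum 'I_N])
     (1 - f y / z) ^ (- \sum_(s < N | xx s == y) gam s * epsv_varpi i (ii s)) =
  points_prod ii (fun s => f (xx s)) i z.
Proof.
move=> h0 gam1 i0.
have -> : \prod_(y <- undup [seq xx s | s <- enum 'I_N])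
     (1 - f y / z) ^ (- \sum_(s < N | xx s == y) gam s * epsv_varpi i (ii s)) =
     \prod_(s < N | (ii s < i)%N) (1 - f (xx s) / z) ^ gam s.
  have expsum (y : F) (P : pred 'I_N) (g : 'I_N -> int) : y != 0 ->
      y ^ (\sum_(s < N | P s) g s) = \prod_(s < N | P s) y ^ g s.
    move=> y0; apply: (big_morph (fun k : int => y ^ k)) => [k l|]; last exact: expr0z.
    exact: expfzDr.
  transitivity (\prod_(y <- undup [seq xx s | s <- enum 'I_N])
     \prod_(s < N | xx s == y) (1 - f (xx s) / z) ^ (- (gam s * epsv_varpi i (ii s)))).
    apply: eq_big_seq => y; rewrite mem_undup => /mapP[s0 _ ->].
    rewrite -sumrN expsum //; apply: eq_bigr => s /eqP e; by rewrite e.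
  (* For fixed [s], the list without repetitions contains [xx s] exactly once. *)
  rewrite (exchange_big_dep predT) //= [RHS]big_mkcond; apply: eq_bigr => s _.
  rewrite -big_filter (_ : [seq y <- _ | xx s == y] = [:: xx s]) ?big_seq1; last first.
    have xin : xx s \in undup [seq xx s | s <- enum 'I_N].
      by rewrite mem_undup; apply: map_f; rewrite mem_enum.
    by rewrite (eq_filter (a2 := pred1 (xx s))) ?filter_pred1_uniq ?undup_uniq // => y; rewrite eq_sym.
  by rewrite /epsv_varpi; case: ifP => _; rewrite ?mulr0 ?oppr0 ?expr0z // mulrN1 opprK.
have -> : \prod_(s < N | ii s == 0%N) (1 - v ^- 0 * f (xx s) / z) ^ gam s =
    \prod_(s < N | ii s == 0%N) (1 - f (xx s) / z) ^ gam s.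
  by apply: eq_bigr => s _; rewrite expr0 invr1 mul1r.
rewrite [X in _ * X](bigID (fun s => ii s == 0%N)) /=.
rewrite [X in _ * (X * _)](eq_bigl (fun s => ii s == 0%N)) => [|s]; last by lia.
rewrite mulKf; last first.
  by apply/prodf_neq0 => s _; apply: expfz_neq0.
rewrite /points_prod; apply: eq_big => [s|s /andP[_ s0]]; first by lia.
by rewrite gam1.
Qed.

Lemma collect_factors (F : fieldType) (c zi f ph p1 p2 z2 A B G e ep : F) :
  c * zi * (f * ph * (p1 * p2 * z2 * (A / B) * G) * (e * ep)) =
  f * (p1 * p2) * e * (c * z2 * (zi * G) * A * ph * ep / B).
Proof. by move: (B^-1) => B'; ring. Qed.

Lemma one_sub_div_neq0 (F : fieldType) (z c : F) : z != 0 -> z != c -> 1 - c / z != 0.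
Proof.
move=> z0 zc; have -> : 1 - c / z = (z - c) / z by rewrite mulrBl divff.
by rewrite mulf_neq0 ?invr_eq0 // subr_eq0.
Qed.

Lemma move_inv_e (F : fieldType) (c p y pole r s : F) :
  c * (p / y * pole * r * s) = c * (p * pole * r * s) * y^-1.
Proof. by move: (y^-1) => y'; ring. Qed.

Lemma move_inv_f (F : fieldType) (c y pole s : F) : c * (y^-1 * pole * s) = c * (pole * s) * y^-1.
Proof. by move: (y^-1) => y'; ring. Qed.

(** * From formal terms to the factored terms *)

Section Link.

Variables (n N : nat) (ii : 'I_N -> nat) (xx : 'I_N -> Cx) (gam : 'I_N -> int)
  (mup mum : nat -> int) (a : nat -> nat).

Local Notation K := {fraction {mpoly Cx[nvar n a]}}.
Local Notation Kz := (Kz n a).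
Local Notation Kv := (Kv n a).
Local Notation Uvar := (Uvar n a).
Local Notation b := (aa n a).
Local Notation x := (fun s => cst n a (xx s)).
Local Notation lam := (lam ii gam).
Local Notation rtup := (rtup n a).

Hypothesis divD : trig_divisor n ii xx gam mup mum.

(** The exponent of [z] in the prefactor plus that in [g_i]. *)
Definition Mexp (i : nat) : int := lam 1 + mum 1 + mup i.

Lemma shift_expD i t (U : Assign n a) : shift (expD i t 1) U = shiftD Kv i t U.
Proof.
apply: functional_extensionality => k; apply: functional_extensionality => r.
by rewrite /shift /expD /shiftD; case: ifP => _; rewrite ?expr0z ?mul1r ?expr1z.
Qed.

Lemma shift_expo0 (U : Assign n a) : shift expo0 U = U.
Proof.
apply: functional_extensionality => k; apply: functional_extensionality => r.
by rewrite /shift /expo0 expr0z mul1r.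
Qed.

Lemma expD_nil i sg : expD i [::] sg = expo0.
Proof.
apply: functional_extensionality => k; apply: functional_extensionality => r.
by rewrite /expD addn0; case: ltngtP.
Qed.

Definition f_term (al : nat) (U : Assign n a) (i : nat) (t : seq nat) : K :=
  fcoef_free Kv b U al i t * phi Kv U al i t Kz.

Definition e_term (be : nat) (U : Assign n a) (i : nat) (t : seq nat) : K :=
  ecoef_free Kv b mup ii x U i be t * eps Kv be U i t Kz.

Lemma ZfE i (y : K) : (0 < i)%N -> Zf ii xx gam i y = Z Kv ii x i y.
Proof.
case: divD => _ [_ [g1 _]] i0; apply: eq_bigr => s /eqP e.
by rewrite g1 ?expr1z // e; lia.
Qed.

(** The diagonal entry 1 is the case of the empty tuple, which makes the sums over tuples uniform in
    [i]. *)
Lemma fDE al i : (i <= al)%N ->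
  fD n a al i = [seq ((fun U : Assign n a => f_term al U i t), expD i t 1) | t <- rtup i al].
Proof.
rewrite /fD; have [->|ne] := eqVneq i al => il.
  rewrite /Defs.rtup subnn /= expD_nil; congr [:: (_, _)].
  by apply: functional_extensionality => U; rewrite /f_term /fcoef_free /phi eqxx ltnn mul1r.
have il' : (i < al)%N by rewrite ltn_neqAle ne.
rewrite il'; apply: eq_map => t; congr (_, _); apply: functional_extensionality => U.
by rewrite /f_term /fcoef_free /phi (negPf ne) il' /fcoef move_inv_f /pole -!(rk_head t i).
Qed.

Lemma eDE be i : (0 < i)%N -> (i <= be)%N ->
  eD n ii xx gam mup a i be =
  [seq ((fun U : Assign n a => e_term be U i t), expD i t (-1)) | t <- rtup i be].
Proof.
rewrite /eD; have [->|ne] := eqVneq i be => i0 il.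
  rewrite /Defs.rtup subnn /= expD_nil; congr [:: (_, _)].
  by apply: functional_extensionality => U; rewrite /e_term /ecoef_free /eps eqxx ltnn mul1r.
have il' : (i < be)%N by rewrite ltn_neqAle ne.
rewrite il'; apply: eq_map => t; congr (_, _); apply: functional_extensionality => U.
rewrite /e_term /ecoef_free /eps (negPf ne) il' /ecoef move_inv_e -!(rk_head t i).
congr (_ * (_ * _ * _) / _); apply: eq_big_nat => k /andP[ik _]; apply: ZfE; lia.
Qed.

(** The shift by [tf] starts at layer [i], so [W_{i-1}] can be taken at the unshifted variables. *)
Lemma term_value al be i tf te (U := shiftD Kv i tf Uvar) : (0 < i)%N ->
  Kz ^ (lam 1 + mum 1) * (Zf ii xx gam 0 Kz)^-1 *
    (f_term al Uvar i tf * gD ii xx gam mup U i * e_term be U i te) =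
  coef Kv b Uvar al be mup ii x i tf te *
    (level Kv b Uvar al be Mexp ii x i tf te Kz / W b Uvar i.-1 (Kv ^- i.+1 * Kz)).
Proof.
move=> i0; have -> : W b Uvar i.-1 (Kv ^- i.+1 * Kz) = W b U i.-1 (Kv ^- i.+1 * Kz).
  by apply/esym/eq_W/shiftD_below; lia.
have nz s : 1 - cst n a (xx s) / Kz != 0.
  by apply: one_sub_div_neq0; [exact: Kz_neq0|exact: Kz_neq_cst].
case: divD => _ [_ [g1 _]].
rewrite /coef /level -(prod_points_Z0 Kv nz g1 i0) /Mexp expfzDr; last exact: Kz_neq0.
exact: collect_factors.
Qed.

Definition exponent i tf te : Expo := fun k r => expD i tf 1 k r + expD i te (-1) k r.

(** Only [f] shifts the factors to its right, since [g_i] contains no [D]; hence [g_i] and [e] are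
    taken at the same shifted variables. *)
Lemma coefAt_sTD al be e : coefAt (sTD n ii xx gam mup mum a al be) e =
  \sum_(i <- iota 1 (minn al be)) \sum_(tf <- rtup i al) \sum_(te <- rtup i be)
    (if expeq n a (exponent i tf te) e then
       coef Kv b Uvar al be mup ii x i tf te *
         (level Kv b Uvar al be Mexp ii x i tf te Kz / W b Uvar i.-1 (Kv ^- i.+1 * Kz))
     else 0).
Proof.
rewrite /coefAt big_mkcond /sTD /tmul big_allpairs_dep big_seq1 /TD big_flatten big_map.
apply: eq_big_seq => i; rewrite mem_iota => hi.
rewrite big_allpairs_dep big_allpairs_dep fDE; last by lia.
rewrite big_map; apply: eq_bigr => tf _.
rewrite big_seq1 eDE; [|by lia..].
rewrite big_map; apply: eq_bigr => te _ /=.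
have add0 : (fun k r => expD i tf 1 k r + expo0 k r) = expD i tf 1.
  by do 2![apply: functional_extensionality => ?]; rewrite addr0.
have -> : (fun k r => expo0 k r + (expD i tf 1 k r + expo0 k r + expD i te (-1) k r)) =
    exponent i tf te.
  by do 2![apply: functional_extensionality => ?]; rewrite add0r addr0.
rewrite shift_expo0 add0 shift_expD -term_value //; lia.
Qed.

Lemma expeq_ext (e1 e2 e : Expo) : (forall k r, e1 k r = e2 k r) ->
  expeq n a e1 e = expeq n a e2 e.
Proof. by move=> h; apply: eq_all => k; apply: eq_all => r; rewrite h. Qed.

(** The [D_{i,r}] of [f] and the [D_{i,r}^{-1}] of [e] cancel in the monomial. *)
Lemma exponent_cons i r tf te k s :
  exponent i (r :: tf) (r :: te) k s = exponent i.+1 tf te k s.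
Proof.
rewrite /exponent /expD /= !addnS !addSn.
case: (ltngtP i k) => [ik|ki|<-] /=.
- by rewrite !rk_cons.
- by [].
- by rewrite !rk_head /= !leq_addr; case: ifP => _; rewrite ?addrN ?addr0.
Qed.

(** * Order of the terms at [z = 0] *)

Hypothesis intD : integrality n ii gam mup mum a.

Lemma lam_step j : lam 1 - lam j = \sum_(s < N) gam s * ((ii s < j)%N%:Z - (ii s < 1)%N%:Z).
Proof.
rewrite /Defs.lam -sumrB; apply: eq_bigr => s _; rewrite -mulrBr /epsv_varpi.
by congr (_ * _); case: ifP; case: ifP.
Qed.

(** Points with [i_s = 0] contribute equally to all coordinates from the first on, whatever their
    sign; each other point lowers the coordinates after [i_s] by 1. *)
Lemma lam_count j : (0 < j)%N -> lam 1 - lam j = #|[pred s | (0 < ii s < j)%N]|%:Z.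
Proof.
case: divD => _ [_ [g1 _]] j0.
rewrite lam_step -sum1_card [in RHS]big_mkcond (big_morph Posz PoszD (erefl 0%:Z)).
apply: eq_bigr => s _; have [e|ne] := eqVneq (ii s) 0%N.
  by rewrite inE e j0 /= subrr mulr0.
rewrite g1 // mul1r.
by rewrite inE ltnS leqn0 lt0n (negPf ne) subr0; case: ltnP.
Qed.

Lemma mum_le i : (1 <= i <= n)%N -> mum i <= mum 1.
Proof.
case: divD => _ [_ [_ [_ [_ dm]]]]; elim: i => // -[|i] IH hi //.
have := dm i.+1; rewrite /alphav; have := IH; lia.
Qed.

(** Consecutive roots overlap in one coordinate; [aa] vanishes at 0 and [n], which covers the two
    ends. *)
Lemma alpha_sum i : (0 < i)%N ->
  \sum_(1 <= k < n) (a k)%:Z * epsv_alpha i k = (b i)%:Z - (b i.-1)%:Z.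
Proof.
move=> hi; rewrite /epsv_alpha.
under eq_bigr do rewrite mulrBr.
rewrite sumrB.
have sumE j : \sum_(1 <= k < n) (a k)%:Z * (j == k)%:Z = (b j)%:Z.
  rewrite /aa; case: ifP => hj.
    rewrite (bigD1_seq j) ?iota_uniq ?mem_index_iota //= eqxx mulr1 big1 ?addr0 // => k kj.
    by rewrite eq_sym (negPf kj) mulr0.
  rewrite big_nat big1 // => k hk; case: eqP => [e|_]; last by rewrite mulr0.
  by rewrite e hk in hj.
rewrite sumE; congr (_ - _); rewrite -sumE; apply: eq_bigr => k _.
by congr (_ * _%:Z); congr nat_of_bool; apply/eqP/eqP; lia.
Qed.

(** Integrality at coordinate [i] turns the left side into the [lam] difference, which counts
    points, plus [mum 1 - mum i], which is nonnegative by dominance and so equals its absolute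
    value. *)
Lemma Mexp_degree al i : (al <= n)%N -> (0 < i <= al)%N ->
  Mexp i + (b i.-1)%:Z - (b i)%:Z =
  `|mum 1 - mum i|%N%:Z + #|[pred s | (0 < ii s < i)%N]|%:Z.
Proof.
move=> aln hi; have hi' : (1 <= i <= n)%N by lia.
rewrite -lam_count; last by lia.
have := intD hi'; rewrite alpha_sum ?(proj1 (andP hi')) // /Mexp.
have := mum_le hi'; lia.
Qed.

End Link.

Theorem theorem3p20 (n N : nat) (ii : 'I_N -> nat) (xx : 'I_N -> Cx) (gam : 'I_N -> int)
    (mup mum : nat -> int) (a : nat -> nat) :
  (2 <= n)%N ->
  trig_divisor n ii xx gam mup mum ->
  integrality n ii gam mup mum a ->
  forall al be : nat, (1 <= al <= n)%N -> (1 <= be <= n)%N ->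
    in_Az (sTD n ii xx gam mup mum a al be).
Proof.
move=> n2 divD intD al be hal hbe e; rewrite coefAt_sTD //.
have valid i r : (0 < r <= aa n a i)%N -> validx n a i r.
  by rewrite /validx /aa; case: ifP => //; lia.
(* The selector [E] keeps the terms whose monomial is [e], and [delta] is the order at [z = 0] found
   in [Mexp_degree]. *)
have [||||||||||||||||||P RP PE] := @total_regular _ (Kv n a) (aa n a) (Uvar n a) al be mup
  (Mexp ii gam mup mum) (fun i => `|mum 1 - mum i|%N) N ii (fun s => cst n a (xx s))
  _ _ _ _ _ (@inR n a) (Kz n a) (fun i tf te => expeq n a (exponent i tf te) e).
- exact: Kv_neq0.
- by move=> i r /valid; apply: Uvar_neq0.
- by move=> i j r s k l /valid vr /valid vs; apply: exp_wv_inj.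
- by move=> i; rewrite /Mexp /alphav; ring.
- by move=> i hi; apply: (Mexp_degree divD intD) hi; lia.
- exact: inR0.
- exact: inR1.
- exact: inRN.
- exact: inRD.
- exact: inRM.
- by move=> s; apply: inR_cst.
- exact: inR_Kv_expz.
- by move=> i r; split; [exact: inR_Uvar|exact: inRV_Uvar].
- by move=> i r s k /valid vr /valid vs; apply: inRV_one_sub_wv.
- by [].
- exact: Kz_neq0.
- by move=> i r k /valid; apply: Kz_neq_exp_wv.
- by move=> i r tf te; apply: expeq_ext => k s; apply: exponent_cons.
rewrite (_ : \sum_(_ <- _) _ = P.[Kz n a]); last exact: PE.
exact: inRz_horner.
Qed.
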